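(* Let $n,m\ge1$ be integers, $\Phi\in\mathcal{C}$ and $K\in\mathcal{K}_{(o)}^{n,1}$. Then $\Pi_\Phi^mK\in\mathcal{K}_{(o)}^{n,m}$; i.e., the function $h_{\Pi_\Phi^mK}$ on $M_{n,m}(\mathbb{R})$ is the support function of a (unique) convex body $\Pi_\Phi^mK$ in $M_{n,m}(\mathbb{R})$, and this body contains the origin in its interior.
   Context: $M_{n,m}(\mathbb{R})$ is the space of real $n\times m$ matrices with inner product $\pmb{x}\cdot\pmb{y}=\mathrm{tr}(\pmb{x}^{\mathrm T}\pmb{y})$, identified with $\mathbb{R}^{nm}$; $M_{n,1}(\mathbb{R})=\mathbb{R}^n$ (columns), and $M_{1,m}(\mathbb{R})$ consists of row vectors. $V_n$ is the volume on $M_{n,1}(\mathbb{R})$. A convex body is a compact convex set with nonempty interior; $\mathcal{K}_{(o)}^{n,m}$ is the set of convex bodies in $M_{n,m}(\mathbb{R})$ containing the origin $o$ in their interior. $S^{n-1}$ is the Euclidean unit sphere of $M_{n,1}(\mathbb{R})$. The support function of a convex body $K$ is $h_K(\pmb{x})=\max\{\pmb{x}\cdot\pmb{y}:\pmb{y}\in K\}$, and $S_K$ is the surface area measure of $K\in\mathcal{K}_{(o)}^{n,1}$ on $S^{n-1}$ (the $\mathcal{H}^{n-1}$-measure of the set of boundary points having an outer unit normal in the given Borel set). $\mathcal{C}$ is the set of convex functions $\Phi:M_{1,m}(\mathbb{R})\to[0,\infty)$ with $\Phi(o)=0$ and $\Phi(z)+\Phi(-z)>0$ for all $z\neq o$.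 For $\Phi\in\mathcal{C}$ and $K\in\mathcal{K}_{(o)}^{n,1}$ the function $h_{\Pi_\Phi^mK}$ on $M_{n,m}(\mathbb{R})$ is defined by $h_{\Pi_\Phi^mK}(o)=0$ and, for $\pmb{x}\ne o$, $$h_{\Pi_\Phi^mK}(\pmb{x})=\inf\Big\{\tfrac1t>0:\int_{S^{n-1}}\Phi\Big(t\,\frac{u^{\mathrm T}\pmb{x}}{h_K(u)}\Big)h_K(u)\,dS_K(u)\le nV_n(K)\Big\},$$ where $u^{\mathrm T}\pmb{x}\in M_{1,m}(\mathbb{R})$ is the matrix product. *)

(* Defs.v *)
From HB Require Import structures.
From mathcomp Require Import all_boot all_order all_algebra.
From mathcomp Require Import all_classical all_reals all_analysis.

Set Implicit Arguments.
Unset Strict Implicit.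
Unset Printing Implicit Defensive.

Import Order.TTheory GRing.Theory Num.Theory.
Import numFieldNormedType.Exports.

Local Open Scope classical_set_scope.
Local Open Scope ring_scope.

Section Euclidean.
Context {R : realType} {n m : nat}.
Implicit Types (x y : 'M[R]_(n, m)) (K : set 'M[R]_(n, m)).

Definition dotmx x y : R := \tr (x^T *m y).

(* The library norm `|x| on matrices is the sup norm. It induces the same
   topology, but lengths and diameters below are Euclidean. *)
Definition enorm x : R := Num.sqrt (dotmx x x).

Definition ediam K : \bar R :=
  ereal_sup [set (enorm (p.1 - p.2))%:E | p in K `*` K].

Definition convex_body K : Prop :=
  [/\ convex_set K, compact K & K° !=set0].

Definition convex_body_o K : Prop := convex_body K /\ K° 0.

(* For compact nonempty K the supremum is a maximum. *)
Definition support_fun K x : R := sup [set dotmx x y | y in K].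

Definition bdry K : set 'M[R]_(n, m) := closure K `\` K°.

End Euclidean.

Section Measures.
Context {R : realType}.
Local Open Scope ereal_scope.

(* Lebesgue measure on R^n, as the outer measure given by countable covers by
   closed boxes. *)
Definition volume n (A : set 'cV[R]_n) : \bar R :=
  ereal_inf
    [set \sum_(0 <= k <oo) (\prod_(i < n) (ab.2 k i 0 - ab.1 k i 0)%R)%:E |
     ab in [set ab : (nat -> 'cV[R]_n) * (nat -> 'cV[R]_n) |
       (forall k i, (ab.1 k i 0 <= ab.2 k i 0)%R) /\
       A `<=` \bigcup_k [set x : 'cV[R]_n |
         forall i, (ab.1 k i 0 <= x i 0 <= ab.2 k i 0)%R]]].

(* Volume of the Euclidean unit ball of R^s: 1, 2, pi, 4 pi / 3, ... *)
Fixpoint ball_volume (s : nat) : R :=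
  match s with
  | 0%N => 1%R
  | 1%N => 2%R
  | s'.+2 => (2 * pi / s%:R * ball_volume s')%R
  end.

(* The empty set gets weight 0 also when s = 0, where a nonempty set gets
   weight 1 (so that the 0-dimensional measure is the counting measure).  It
   is only used for sets of finite diameter. *)
Definition hausdorff_weight n (s : nat) (A : set 'cV[R]_n) : \bar R :=
  if `[< A = set0 >] then 0
  else (ball_volume s * (fine (ediam A) / 2) ^+ s)%R%:E.

Definition hausdorff_premeasure n (s : nat) (delta : R) (A : set 'cV[R]_n)
    : \bar R :=
  ereal_inf
    [set \sum_(0 <= k <oo) hausdorff_weight s (F k) |
     F in [set F : nat -> set 'cV[R]_n |
       (forall k, ediam (F k) <= delta%:E) /\ A `<=` \bigcup_k F k]].

(* s-dimensional Hausdorff measure, normalized to agree with Lebesgue measure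
   on R^s. *)
Definition hausdorff n (s : nat) (A : set 'cV[R]_n) : \bar R :=
  ereal_sup [set hausdorff_premeasure s delta A |
             delta in [set delta : R | (0 < delta)%R]].

End Measures.

Section SurfaceArea.
Context {R : realType} {n : nat}.
Implicit Types (K : set 'cV[R]_n).

Definition borelcV : measurableType _ :=
  g_sigma_algebraType (@open 'cV[R]_n).

Definition usphere : set borelcV := [set u : 'cV[R]_n | enorm u = 1].

Definition outer_unit_normal K (y u : 'cV[R]_n) : Prop :=
  usphere u /\ forall z, K z -> dotmx u z <= dotmx u y.

(* S_K is viewed as a set function on the Borel subsets of R^n, carried by the
   unit sphere. *)
Definition surface_area K (omega : set borelcV) : \bar R :=
  hausdorff n.-1
    [set y | bdry K y /\ exists2 u, omega u & outer_unit_normal K y u].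

End SurfaceArea.

Section OrliczProjection.
Context {R : realType}.

Record orlicz_class m (Phi : 'rV[R]_m -> R) : Prop := OrliczClass {
  orlicz_convex : convex_function setT Phi;
  orlicz_ge0 : forall z, 0 <= Phi z;
  orlicz_0 : Phi 0 = 0;
  orlicz_gt0 : forall z, z != 0 -> 0 < Phi z + Phi (- z)
}.

(* Extended-real valued, with the infimum of the empty set equal to +oo. *)
Definition h_proj n m (Phi : 'rV[R]_m -> R) (K : set 'cV[R]_n)
    (x : 'M[R]_(n, m)) : \bar R :=
  if x == 0 then 0%E
  else ereal_inf
    [set (t^-1)%:E | t in [set t : R | 0 < t /\
      (\int[surface_area K]_(u in usphere)
         (Phi ((t / support_fun K u) *: (u^T *m x)) * support_fun K u)%:E
       <= n%:R%:E * volume K)%E]].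

End OrliczProjection.

(* Main.v *)
(* The surface area measure is only needed through three properties of the set
   function S_K: it is monotone and countably subadditive, its sums over disjoint
   Borel families are bounded, and it charges every open half-space. The integral
   against such a set function, a supremum over simple functions, is convex in the
   integrand, so G(x) = int Phi(u^T x / h_K) h_K dS_K is a finite convex function
   with G(0) = 0, and h_proj is the gauge of {G <= n V(K)}. It is positive away
   from 0 because G grows linearly along each ray: the rays on which Phi vanishes form
   a pointed cone, hence u |-> u^T x avoids that cone on an open half-space. A positive
   sublinear function is the support function of a body around the origin by the
   Hahn-Banach theorem, and separation gives uniqueness.

   Boundedness over disjoint families: with U(A) the set of all p + s u, where
   1 <= s <= 2 and u in A is normal to K at p, A |-> H^n(U(A)) is a metric outer
   measure, so it is additive on Borel sets, and it dominates S_K up to a constant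
   by Eilenberg's inequality. Thus neither the null set of singular boundary points
   nor the measurability of the reverse spherical images is needed. *)
From HB Require Import structures.
From Pilot Require Import Defs.
From mathcomp Require Import all_boot all_order all_algebra.
From mathcomp Require Import finmap.
From mathcomp Require Import all_classical all_reals all_analysis.
From mathcomp Require Import measurable_realfun ring lra.
(* MathComp also has a [dotmx]; the second import restores the one of Defs. *)
Import Pilot.Defs.

Import Order.TTheory GRing.Theory Num.Theory.
Import numFieldNormedType.Exports.

Local Open Scope classical_set_scope.
Local Open Scope ring_scope.

(** * The Euclidean inner product on matrices *)

(** Reverse spherical images of disjoint sets of normals overlap at boundary points with several
    normals, so additivity of S_K cannot be read off its definition. In the parallel set the overlap
    is gone: p and u are recovered from p + s u, and since normals are monotone the recovery
    satisfies a Lipschitz estimate, which is what makes A |-> H^n(U(A)) metric. Additivity reaches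
    S_K only as a bound on sums over disjoint families. That still gives convexity of the integral,
    because a simple function can tell apart the pieces of any finite partition by giving them
    slightly different coefficients. *)

Lemma continuous_sumr {R : realType} {T : topologicalType} (I : finType)
    (F : I -> T -> R) :
  (forall i, continuous (F i)) -> continuous (fun x => \sum_i F i x).
Proof.
move=> cF; apply: (@continuous_big R I +%R 0 xpredT) => [|i _]; last exact: cF.
by move=> z; apply: cvgD; [exact: cvg_fst|exact: cvg_snd].
Qed.

Section Dot.
Context {R : realType} {n m : nat}.
Implicit Types (x y z : 'M[R]_(n, m)) (a : R).

Lemma dotmxE x y : dotmx x y = \sum_i \sum_j x j i * y j i.
Proof.
by rewrite /dotmx /mxtrace; apply: eq_bigr => i _; rewrite mxE;
  apply: eq_bigr => j _; rewrite mxE.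
Qed.

Lemma dotmxC x y : dotmx x y = dotmx y x.
Proof.
by rewrite !dotmxE; apply: eq_bigr => i _; apply: eq_bigr => j _; rewrite mulrC.
Qed.

Lemma dotmxDr x y z : dotmx x (y + z) = dotmx x y + dotmx x z.
Proof. by rewrite /dotmx mulmxDr mxtraceD. Qed.

Lemma dotmxZr a x y : dotmx x (a *: y) = a * dotmx x y.
Proof. by rewrite /dotmx -scalemxAr mxtraceZ. Qed.

Lemma dotmxNr x y : dotmx x (- y) = - dotmx x y.
Proof. by rewrite -scaleN1r dotmxZr mulN1r. Qed.

Lemma dotmx0r x : dotmx x 0 = 0.
Proof. by rewrite -(scale0r 0) dotmxZr mul0r. Qed.

Lemma dotmxDl x y z : dotmx (x + y) z = dotmx x z + dotmx y z.
Proof. by rewrite dotmxC dotmxDr !(dotmxC z). Qed.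

Lemma dotmxZl a x y : dotmx (a *: x) y = a * dotmx x y.
Proof. by rewrite dotmxC dotmxZr dotmxC. Qed.

Lemma dotmxNl x y : dotmx (- x) y = - dotmx x y.
Proof. by rewrite dotmxC dotmxNr dotmxC. Qed.

Lemma dotmx0l x : dotmx 0 x = 0.
Proof. by rewrite dotmxC dotmx0r. Qed.

Definition dotmx_lin :=
  (dotmxDr, dotmxDl, dotmxZr, dotmxZl, dotmxNr, dotmxNl, dotmx0r, dotmx0l).

Lemma dotmx_ge0 x : 0 <= dotmx x x.
Proof. by rewrite dotmxE; do 2!apply: sumr_ge0 => ? _; rewrite -expr2 sqr_ge0. Qed.

Lemma coord_dotmx x i j : x i j ^+ 2 <= dotmx x x.
Proof.
rewrite dotmxE (bigD1 j)//= (bigD1 i)//= -expr2 -addrA lerDl addr_ge0//.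
  by apply: sumr_ge0 => ? _; rewrite -expr2 sqr_ge0.
by do 2!apply: sumr_ge0 => ? _; rewrite -expr2 sqr_ge0.
Qed.

Lemma dotmx_gt0 x : x != 0 -> 0 < dotmx x x.
Proof.
move=> x0; rewrite lt_neqAle dotmx_ge0 andbT; apply: contra x0 => /eqP x0.
apply/eqP/matrixP => i j; rewrite mxE; apply/eqP; rewrite -sqrf_eq0 eq_le sqr_ge0 andbT.
by rewrite x0 coord_dotmx.
Qed.

Lemma enorm_ge0 x : 0 <= enorm x.
Proof. exact: sqrtr_ge0. Qed.

Lemma enorm_sq x : enorm x ^+ 2 = dotmx x x.
Proof. by rewrite sqr_sqrtr// dotmx_ge0. Qed.

Lemma enorm0 : enorm (0 : 'M[R]_(n, m)) = 0.
Proof. by rewrite /enorm dotmx0r sqrtr0. Qed.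

Lemma enorm_gt0 x : x != 0 -> 0 < enorm x.
Proof. by move=> x0; rewrite sqrtr_gt0 dotmx_gt0. Qed.

Lemma enormZ a x : enorm (a *: x) = `|a| * enorm x.
Proof.
by rewrite /enorm !dotmx_lin mulrA -expr2 sqrtrM ?sqr_ge0// sqrtr_sqr.
Qed.

Lemma enormN x : enorm (- x) = enorm x.
Proof. by rewrite -scaleN1r enormZ normrN1 mul1r. Qed.

Lemma enormB x y : enorm (x - y) = enorm (y - x).
Proof. by rewrite -enormN opprB. Qed.

Lemma ler_sqr_enorm x a : 0 <= a -> (enorm x <= a) = (dotmx x x <= a ^+ 2).
Proof. by move=> a0; rewrite -enorm_sq ler_pXn2r// nnegrE ?enorm_ge0. Qed.

Lemma ler_enorm_dot x y : dotmx x x <= dotmx y y -> enorm x <= enorm y.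
Proof. by move=> xy; rewrite ler_sqr_enorm ?enorm_ge0// enorm_sq. Qed.

Lemma ler_enorm_acute x y : 0 <= dotmx x y -> enorm x <= enorm (x + y).
Proof.
move=> xy; apply: ler_enorm_dot; rewrite !dotmx_lin (dotmxC y x).
by have := dotmx_ge0 y; lra.
Qed.

Lemma cauchy_schwarz x y : dotmx x y <= enorm x * enorm y.
Proof.
have [->|y0] := eqVneq y 0; first by rewrite dotmx0r enorm0 mulr0.
have b0 := dotmx_gt0 _ y0.
have := dotmx_ge0 (dotmx y y *: x - dotmx x y *: y).
rewrite !dotmx_lin (dotmxC y x).
set a := dotmx x y; set b := dotmx y y in b0 *; set c := dotmx x x => H.
have {}H : 0 <= b * (b * c - a ^+ 2) by apply: le_trans H _; rewrite le_eqVlt; apply/orP; left;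
  apply/eqP; ring.
have {}H : a ^+ 2 <= c * b by move: H; rewrite pmulr_rge0// subr_ge0 mulrC.
apply: le_trans (ler_norm _) _.
rewrite -sqrtr_sqr /enorm -sqrtrM ?dotmx_ge0//; exact: ler_wsqrtr.
Qed.

Lemma ler_enormD x y : enorm (x + y) <= enorm x + enorm y.
Proof.
rewrite ler_sqr_enorm ?addr_ge0 ?enorm_ge0// sqrrD !enorm_sq !dotmx_lin (dotmxC y x).
have := cauchy_schwarz x y; lra.
Qed.

Lemma ler_coord_enorm x i j : `|x i j| <= enorm x.
Proof. by rewrite -sqrtr_sqr; apply: ler_wsqrtr; exact: coord_dotmx. Qed.

Lemma ler_coord_norm x i j : `|x i j| <= `|x|.
Proof.
rewrite [leRHS]/Num.norm/= mx_normrE; apply/bigmax_geP; right.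
by exists (i, j).
Qed.

Lemma ler_mx_norm x a : 0 <= a -> (forall i j, `|x i j| <= a) -> `|x| <= a.
Proof.
by move=> a0 xa; rewrite [leLHS]/Num.norm/= mx_normrE; apply/bigmax_leP; split.
Qed.

Lemma ler_norm_enorm x : `|x| <= enorm x.
Proof. by apply: ler_mx_norm (enorm_ge0 _) _ => i j; exact: ler_coord_enorm. Qed.

(** The factor is cruder than the square root of m * n, but it is a positive integer even when m * n
    = 0, so later proofs can divide by it. *)
Lemma ler_enorm_coord x a : 0 <= a -> (forall i j, `|x i j| <= a) ->
  enorm x <= (m * n).+1%:R * a.
Proof.
move=> a0 xa; rewrite ler_sqr_enorm ?mulr_ge0// dotmxE.
apply: (@le_trans _ _ ((m * n)%:R * a ^+ 2)).
  apply: (@le_trans _ _ (\sum_(i < m) \sum_(j < n) a ^+ 2)).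
    do 2!apply: ler_sum => ? _.
    by rewrite -expr2 -[leLHS]ger0_norm ?sqr_ge0// normrX ler_pXn2r// nnegrE.
  by rewrite !sumr_const !card_ord -mulrnA mulnC mulr_natl.
rewrite exprMn ler_wpM2r ?sqr_ge0//.
by rewrite -natrX ler_nat (leq_trans (leqnSn _))// leq_pmulr.
Qed.

Lemma ler_enorm_norm x : enorm x <= (m * n).+1%:R * `|x|.
Proof. by apply: ler_enorm_coord => // i j; exact: ler_coord_norm. Qed.

Lemma continuous_dotmxr x : continuous (dotmx x).
Proof.
have -> : dotmx x = fun y => \sum_i \sum_j x j i * y j i.
  by apply/funext => y; rewrite dotmxE.
apply: (@continuous_sumr _ 'M[R]_(n, m)) => i; apply: (@continuous_sumr _ 'M[R]_(n, m)) => j y.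
have c : (fun z : 'M[R]_(n, m) => z j i) @ y --> y j i by exact: coord_continuous.
exact: (cvgM (cvg_cst (x j i)) c).
Qed.

Lemma continuous_enorm_sub y : continuous (fun x => enorm (x - y)).
Proof.
move=> x; apply: (@continuous_comp _ _ _ (fun x => dotmx (x - y) (x - y)) Num.sqrt);
  last exact: sqrt_continuous.
have -> : (fun x => dotmx (x - y) (x - y)) =
    fun x => \sum_i \sum_j (x j i - y j i) * (x j i - y j i).
  by apply/funext => z; rewrite dotmxE; do 2!apply: eq_bigr => ? _; rewrite !mxE.
apply: (@continuous_sumr _ 'M[R]_(n, m)) => i.
apply: (@continuous_sumr _ 'M[R]_(n, m)) => j z.
have c : (fun x : 'M[R]_(n, m) => x j i - y j i) @ z --> z j i - y j i.
  have c : (fun x : 'M[R]_(n, m) => x j i) @ z --> z j i by exact: coord_continuous.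
  exact: (cvgB c (cvg_cst (y j i))).
exact: (cvgM c c).
Qed.

Lemma continuous_enorm : continuous (@enorm R n m).
Proof.
move=> x; have := continuous_enorm_sub 0 x.
by under eq_fun do rewrite subr0.
Qed.

End Dot.

(** * Compactness and separation *)

Section Compactness.
Context {R : realType} {n m : nat}.
Implicit Types (x y z w : 'M[R]_(n, m)) (A K C : set 'M[R]_(n, m)).

(** Compactness of a cube of row vectors ([rV_compact]) is carried over to matrices by the
    continuous map [vec_mx]. *)
Lemma mx_bounded_closed_compact A (M : R) :
  (forall x, A x -> `|x| <= M) -> closed A -> compact A.
Proof.
move=> bA cA.
pose Q := [set v : 'rV[R]_(n * m) | forall i, `[- M, M]%classic (v ord0 i)].
have cQ : compact Q.
  by apply: (@rV_compact R _ (fun=> `[- M, M]%classic)) => _; exact: segment_compact.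
have cv : continuous (@vec_mx R n m).
  move=> v B /nbhs_ballP[e e0 eB]; apply/nbhs_ballP; exists e => // v' [_ vv'].
  by apply: eB; split=> // i j; rewrite !mxE; exact: vv'.
apply: (subclosed_compact cA (continuous_compact _ cQ) (B := vec_mx @` Q)).
  by apply: continuous_subspaceT.
move=> x Ax; exists (mxvec x); last exact: mxvecK.
move=> i /=; rewrite in_itv/= -ler_norml.
case/mxvec_indexP: i => i j; rewrite mxvecE.
exact: le_trans (ler_coord_norm _ _ _) (bA _ Ax).
Qed.

Lemma compact_mx_bounded K : compact K ->
  exists2 M : R, 0 < M & forall x, K x -> enorm x <= M.
Proof.
move=> cK; have [-> |/set0P K0] := eqVneq K set0; first by exists 1.
have cE : {within K, continuous (@enorm R n m)}.
  by apply: continuous_subspaceT; exact: continuous_enorm.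
have [c _ hc] := compact_EVT_max K0 cK cE.
exists (enorm c + 1); first by rewrite ltr_wpDl// enorm_ge0.
by move=> x Kx; rewrite (le_trans (hc x _)) ?inE// lerDl.
Qed.

Lemma mx_hausdorff : hausdorff_space 'M[R]_(n, m).
Proof. exact: norm_hausdorff. Qed.

Lemma compact_sphere : compact [set x : 'M[R]_(n, m) | enorm x = 1].
Proof.
apply: (@mx_bounded_closed_compact _ 1).
  by move=> x /= <-; exact: ler_norm_enorm.
have -> : [set x : 'M[R]_(n, m) | enorm x = 1] = enorm @^-1` [set 1] by [].
by apply: closed_comp => [x _|]; [exact: continuous_enorm|exact: closed_eq].
Qed.

Lemma nbhs_enormP x A : nbhs x A <->
  exists2 r : R, 0 < r & forall y, enorm (y - x) < r -> A y.
Proof.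
split=> [/nbhs_ballP[r /= r0 rA]|[r r0 rA]].
  exists r => // y yr; apply: rA; rewrite mx_norm_ball /ball_/= distrC.
  exact: le_lt_trans (ler_norm_enorm _) yr.
apply/nbhs_ballP; exists (r / (m * n).+1%:R) => /=; first by rewrite divr_gt0.
move=> y; rewrite mx_norm_ball /ball_/= distrC => xy; apply: rA.
apply: le_lt_trans (ler_enorm_norm _) _.
by rewrite mulrC -ltr_pdivlMr.
Qed.

(** Same notion as [convex_set], with the coefficient a plain real under two inequalities instead of
    an element of a bundled unit interval, so that [lra] and [nra] apply. *)
Definition cvx_closed C := forall x y (t : R), 0 <= t -> t <= 1 -> C x -> C y ->
  C (t *: x + (1 - t) *: y).

Lemma convex_setP C : convex_set C <-> cvx_closed C.
Proof.
split=> [cC x y t t0 t1 Cx Cy|cC x y t /set_mem Cx /set_mem Cy].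
  have := cC x y (Itv01 t0 t1); rewrite !inE; exact.
by rewrite inE; apply: cC.
Qed.

(** Moving from the nearest point [p] towards [k] cannot decrease the distance to [y]; the
    first-order term of this condition is the inequality. *)
Lemma nearest_point C y : cvx_closed C -> closed C -> C !=set0 ->
  exists2 p, C p & forall k, C k -> dotmx (y - p) k <= dotmx (y - p) p.
Proof.
move=> vC cC [k0 Ck0].
(* [C] may be unbounded, so the distance is minimised over its compact part that is no farther from
   [y] than [k0]. *)
pose A := C `&` [set k | enorm (k - y) <= enorm (k0 - y)].
have cA : compact A.
  apply: (@mx_bounded_closed_compact _ (enorm (k0 - y) + enorm y)).
    move=> x [_ /= h]; apply: le_trans (ler_norm_enorm _) _.
    by rewrite -[x in enorm x](subrK y) (le_trans (ler_enormD _ _))// lerD2r.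
  apply: closedI => //.
  have -> : [set k | enorm (k - y) <= enorm (k0 - y)] =
    (fun k => enorm (k - y)) @^-1` [set t | t <= enorm (k0 - y)] by [].
  by apply: closed_comp => [x _|]; [exact: continuous_enorm_sub|exact: closed_le].
have A0 : A !=set0 by exists k0; split => /=.
have cE : {within A, continuous (fun k => enorm (k - y))}.
  by apply: continuous_subspaceT; exact: continuous_enorm_sub.
have [p /set_mem[Cp hp] pmin] := compact_EVT_min A0 cA cE.
have {}pmin k : C k -> enorm (p - y) <= enorm (k - y).
  move=> Ck; have [h|/ltW h] := leP (enorm (k - y)) (enorm (k0 - y)).
    by apply: pmin; rewrite inE.
  exact: le_trans hp h.
exists p => // k Ck.
have {}pmin t : 0 <= t -> t <= 1 ->
    2 * t * dotmx (y - p) (k - p) <= t ^+ 2 * dotmx (k - p) (k - p).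
  move=> t0 t1; have := pmin _ (vC k p t t0 t1 Ck Cp).
  rewrite ler_sqr_enorm ?enorm_ge0// enorm_sq.
  have -> : t *: k + (1 - t) *: p - y = t *: (k - p) - (y - p).
    by apply/matrixP => i j; rewrite !mxE; ring.
  rewrite -[p - y]opprB; move: (y - p) (k - p) => v u.
  rewrite !dotmx_lin (dotmxC u v); nra.
rewrite -subr_le0 -dotmxNr -dotmxDr.
set a := dotmx _ _ in pmin *; set b := dotmx (k - p) (k - p) in pmin.
rewrite leNgt; apply/negP => a0.
have b0 : 0 < b.
  have := pmin 1 ler01 (lexx _); rewrite expr1n; lra.
(* Since t * b <= a, the quadratic inequality at [t] gives 2 * a <= t * b <= a, against a > 0. *)
pose t := Num.min 1 (a / b).
have t0 : 0 < t by rewrite lt_min ltr01 divr_gt0.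
have := pmin t (ltW t0); rewrite ge_min lexx /= => /(_ isT).
rewrite expr2 mulrAC mulrC -!mulrA ler_pM2l// => h.
have : t * b <= a by rewrite -ler_pdivlMr// ge_min lexx orbT.
move: h; rewrite mulrC; lra.
Qed.

Lemma separation C y : cvx_closed C -> closed C -> C !=set0 -> ~ C y ->
  exists2 w, w != 0 & exists2 c, c < dotmx w y & forall k, C k -> dotmx w k <= c.
Proof.
move=> vC cC C0 Cy; have [p Cp hp] := nearest_point C y vC cC C0.
have yp : y - p != 0 by rewrite subr_eq0; apply: contra_notN Cy => /eqP ->.
exists (y - p) => //; exists (dotmx (y - p) p) => //.
by rewrite -subr_gt0 -dotmxNr -dotmxDr dotmx_gt0.
Qed.

Lemma support_fun_max K x : compact K -> K !=set0 ->
  exists2 k, K k & support_fun K x = dotmx x k.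
Proof.
move=> cK K0; have cE : {within K, continuous (dotmx x)}.
  by apply: continuous_subspaceT; exact: continuous_dotmxr.
have [c /set_mem Kc hc] := compact_EVT_max K0 cK cE.
exists c => //; apply/le_anti/andP; split.
  apply: ge_sup; first by exists (dotmx x c), c.
  by move=> _ [k Kk <-]; apply: hc; rewrite inE.
apply: ub_le_sup; last by exists c.
by exists (dotmx x c) => _ [k Kk <-]; apply: hc; rewrite inE.
Qed.

Lemma support_fun_ub K x k : compact K -> K k -> dotmx x k <= support_fun K x.
Proof.
move=> cK Kk; have [M _ hM] := compact_mx_bounded K cK.
apply: ub_le_sup; last by exists k.
exists (enorm x * M) => _ [y Ky <-].
by rewrite (le_trans (cauchy_schwarz _ _))// ler_wpM2l ?enorm_ge0// hM.
Qed.

Lemma convex_body_cvx K : convex_body K -> cvx_closed K.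
Proof. by case=> /convex_setP. Qed.

Lemma convex_body_nonempty K : convex_body K -> K !=set0.
Proof. by case=> _ _ [x /interior_subset Kx]; exists x. Qed.

Lemma convex_body_closed K : convex_body K -> closed K.
Proof. by case=> _ cK _; exact: compact_closed mx_hausdorff cK. Qed.

Lemma support_fun_mem K y : convex_body K ->
  (forall x, dotmx x y <= support_fun K x) -> K y.
Proof.
move=> bK h; apply: contrapT => Ky.
have K0 := convex_body_nonempty K bK; have [_ cK _] := bK.
have [w _ [c cy hc]] :=
  separation K y (convex_body_cvx K bK) (convex_body_closed K bK) K0 Ky.
have [k Kk wk] := support_fun_max K w cK K0.
by have := h w; rewrite wk leNgt (le_lt_trans (hc _ Kk) cy).
Qed.

Lemma support_fun_inj K C : convex_body K -> convex_body C ->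
  support_fun K =1 support_fun C -> K = C.
Proof.
move=> bK bC KC; apply/seteqP; split=> x Kx; apply: support_fun_mem => // w.
  by rewrite -KC; apply: support_fun_ub Kx; case: bK.
by rewrite KC; apply: support_fun_ub Kx; case: bC.
Qed.

End Compactness.

(** * Convex and sublinear functions *)

Section Convex.
Context {R : realType} {n m : nat}.
Implicit Types (x y z w : 'M[R]_(n, m)) (f : 'M[R]_(n, m) -> R).

Definition cvx_fun f := forall x y (t : R), 0 <= t -> t <= 1 ->
  f (t *: x + (1 - t) *: y) <= t * f x + (1 - t) * f y.

Lemma convex_functionP f : convex_function setT f -> cvx_fun f.
Proof.
by move=> cf x y t t0 t1; apply: (cf (Itv01 t0 t1) x y); rewrite inE.
Qed.

Lemma cvx_fun_ray f x (t : R) : cvx_fun f -> f 0 = 0 -> 0 <= t -> t <= 1 ->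
  f (t *: x) <= t * f x.
Proof. by move=> cf f0 t0 t1; have := cf x 0 t t0 t1; rewrite scaler0 addr0 f0 mulr0 addr0. Qed.

Lemma cvx_fun_mid f x y : cvx_fun f -> f (x + y) <= (f (2 *: x) + f (2 *: y)) / 2.
Proof.
move=> cf.
have h : (2^-1 : R) <= 1 by rewrite invf_le1 ?ler1n.
have := cf (2 *: x) (2 *: y) 2^-1 (ltac:(by rewrite invr_ge0)) h.
have -> : 1 - 2^-1 = 2^-1 :> R by lra.
rewrite !scalerA mulVf ?pnatr_eq0// !scale1r; lra.
Qed.

(* Upper bounds along finitely many directions, combined two at a time by
   midpoint convexity, replace Jensen's inequality here. *)
Lemma cvx_fun_upper f (I : eqType) (s : seq I) (e : I -> 'M[R]_(n, m)) :
  cvx_fun f -> f 0 = 0 ->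
  exists L r : R, [/\ 0 <= L, 0 < r & forall (c : I -> R) (d : R),
    d <= r -> (forall k, `|c k| <= d) -> f (\sum_(k <- s) c k *: e k) <= L * d].
Proof.
move=> cf f0; elim: s => [|k s [L [r [L0 r0 IH]]]].
  by exists 0, 1; split=> // c d _ _; rewrite big_nil f0 mul0r.
pose M := `|f (e k)| + `|f (- e k)|.
(* Midpoint convexity doubles all coefficients: 2 * d must stay below [r] for the induction
   hypothesis and below 1 for [cvx_fun_ray]. The final halving makes the slopes add up to L + M. *)
exists (L + M), (Num.min (r / 2) (1 / 2)); split.
- by rewrite addr_ge0// addr_ge0.
- by rewrite lt_min !divr_gt0.
move=> c d; rewrite le_min => /andP[dr d1] cd.
have d0 : 0 <= d by apply: le_trans (cd k).
rewrite big_cons; apply: le_trans (cvx_fun_mid _ _ _ cf) _.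
rewrite scaler_sumr; under eq_bigr do rewrite scalerA.
have h1 : f (\sum_(j <- s) (2 * c j) *: e j) <= L * (2 * d).
  apply: IH; first by lra.
  by move=> j; rewrite normrM ger0_norm// ler_pM2l.
have h2 : f (2 *: (c k *: e k)) <= 2 * d * M.
  have := cd k; rewrite scalerA; case: (leP 0 (c k)) => ck;
    rewrite ?(ger0_norm ck) ?(ltr0_norm ck) => ckd.
    apply: le_trans (cvx_fun_ray f _ _ cf f0 _ _) _; [lra|lra|].
    have := ler_norm (f (e k)); have := normr_ge0 (f (- e k)); rewrite /M => h3 h4.
    have := normr_ge0 (f (e k)); nra.
  rewrite -[2 * c k]opprK scaleNr -scalerN.
  apply: le_trans (cvx_fun_ray f _ _ cf f0 _ _) _; [lra|lra|].
  have := ler_norm (f (- e k)); have := normr_ge0 (f (e k)); rewrite /M => h3 h4.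
  have := normr_ge0 (f (- e k)); nra.
lra.
Qed.

Lemma mx_sum_delta x :
  x = \sum_(k : 'I_n * 'I_m) x k.1 k.2 *: delta_mx k.1 k.2.
Proof. by rewrite {1}[x]matrix_sum_delta pair_bigA. Qed.

(** The upper bound holds for w and for - w, so 0 = f 0 <= (f w + f (- w)) / 2 turns it into a lower
    bound. *)
Lemma cvx_fun_lip0 f : cvx_fun f -> f 0 = 0 ->
  exists L r : R, [/\ 0 <= L, 0 < r & forall w, `|w| <= r -> `|f w| <= L * `|w|].
Proof.
move=> cf f0; have [L [r [L0 r0 h]]] := cvx_fun_upper f _
  (index_enum ('I_n * 'I_m)%type) (fun k => delta_mx k.1 k.2) cf f0.
have {}h w : `|w| <= r -> f w <= L * `|w|.
  move=> wr; rewrite {1}[w]mx_sum_delta.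
  by apply: (h (fun k => w k.1 k.2)) => // k; exact: ler_coord_norm.
exists L, r; split=> // w wr; rewrite ler_norml h// andbT.
have := cvx_fun_mid f (2^-1 *: w) (- (2^-1 *: w)) cf.
rewrite subrr f0 -scalerN !scalerA divff ?pnatr_eq0// !scale1r.
have := h (- w); rewrite normrN => /(_ wr); lra.
Qed.

Lemma cvx_fun_continuous f : cvx_fun f -> continuous f.
Proof.
move=> cf z; pose g w := f (z + w) - f z.
have cg : cvx_fun g.
  move=> x y t t0 t1; have := cf (z + x) (z + y) t t0 t1; rewrite /g.
  have -> : t *: (z + x) + (1 - t) *: (z + y) = z + (t *: x + (1 - t) *: y).
    by apply/matrixP => i j; rewrite !mxE; ring.
  lra.
have g0 : g 0 = 0 by rewrite /g addr0 subrr.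
have [L [r [L0 r0 h]]] := cvx_fun_lip0 g cg g0.
apply/(@cvgrPdist_le _ _ _ (nbhs z) _ f (f z)) => e e0.
have d0 : 0 < Num.min r (e / (L + 1)) by rewrite lt_min r0 divr_gt0// ltr_wpDl.
apply/nbhs_ballP; exists (Num.min r (e / (L + 1))) => // w.
rewrite mx_norm_ball /ball_/= lt_min distrC => /andP[wr we].
have := h (w - z) (ltW wr); rewrite /g [z + _]addrC subrK distrC => /le_trans; apply.
move: we; rewrite ltr_pdivlMr ?ltr_wpDl// => we.
have := normr_ge0 (w - z); nra.
Qed.

End Convex.

(** * Sublinear functions and a finite-dimensional Hahn-Banach theorem *)

Section Sublinear.
Context {R : realType} {n m : nat}.
Implicit Types (x y z w e : 'M[R]_(n, m)) (g : 'M[R]_(n, m) -> R).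

Definition sublinear g :=
  (forall x y, g (x + y) <= g x + g y) /\
  (forall (a : R) x, 0 <= a -> g (a *: x) = a * g x).

Lemma sublinear0 g : sublinear g -> g 0 = 0.
Proof. by move=> [_ h]; have := h 0 0 (lexx _); rewrite scale0r mul0r. Qed.

Lemma sublinear_opp g x : sublinear g -> - g (- x) <= g x.
Proof.
move=> sg; have := sg.1 x (- x); rewrite subrr sublinear0//; lra.
Qed.

Lemma sublinear_cvx g : sublinear g -> cvx_fun g.
Proof.
move=> [sg hg] x y t t0 t1; rewrite -!hg// ?subr_ge0//.
Qed.

Let shift g e x := [set g (x + t *: e) - t * g e | t in [set t : R | 0 <= t]].

(* The infimal convolution of [g] with the linear germ of slope [g e] along the
   ray spanned by [e] is linear on the line spanned by [e]. *)
Lemma sublinear_straighten g e : sublinear g ->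
  exists g', [/\ sublinear g', forall x, g' x <= g x & g' (- e) = - g e].
Proof.
move=> sg; pose g' x := inf (shift g e x).
have lb x t : 0 <= t -> - g (- x) <= g (x + t *: e) - t * g e.
  move=> t0; rewrite -sg.2//; have := sg.1 (x + t *: e) (- x).
  by rewrite addrAC subrr add0r; lra.
have hlb x : has_lbound (shift g e x).
  by exists (- g (- x)) => _ [t t0 <-]; exact: lb.
have ne x : shift g e x !=set0 by exists (g (x + 0 *: e) - 0 * g e), 0 => /=.
have g'_le x t : 0 <= t -> g' x <= g (x + t *: e) - t * g e.
  by move=> t0; apply: ge_inf => //; exists t.
have g'_glb x a : (forall t, 0 <= t -> a <= g (x + t *: e) - t * g e) -> a <= g' x.
  by move=> h; apply: lb_le_inf => // _ [t t0 <-]; exact: h.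
have hom a x : 0 < a -> g' (a *: x) <= a * g' x.
  move=> a0; rewrite -ler_pdivrMl//; apply: (g'_glb _ _) => t t0.
  rewrite ler_pdivrMl//; have := g'_le (a *: x) (a * t) (mulr_ge0 (ltW a0) t0).
  rewrite -scalerA -scalerDr sg.2 ?(ltW a0)//; lra.
have g'g x : g' x <= g x by have := g'_le x 0 (lexx _); rewrite scale0r addr0 mul0r subr0.
have sub' x y : g' (x + y) <= g' x + g' y.
  rewrite -lerBlDr; apply: (g'_glb _ _) => s s0; rewrite lerBlDr -lerBlDl.
  apply: (g'_glb _ _) => t t0; have := g'_le (x + y) (s + t) (addr_ge0 s0 t0).
  rewrite scalerDl addrACA; have := sg.1 (x + s *: e) (y + t *: e); lra.
have g'0 : g' 0 = 0.
  apply/le_anti/andP; split; first by rewrite -(sublinear0 g sg).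
  by apply: (g'_glb _ _) => t t0; rewrite add0r sg.2// subrr.
have sg' : sublinear g'.
  split=> // a x; rewrite le_eqVlt => /predU1P[<-|a0]; first by rewrite scale0r mul0r.
  apply/le_anti; rewrite hom//=.
  have := hom a^-1 (a *: x); rewrite invr_gt0 scalerA mulVf ?gt_eqF// scale1r.
  by move=> /(_ a0); rewrite ler_pdivlMl.
exists g'; split=> //.
(* The term t = 1 of the infimum is g 0 - g e; conversely - g' (- e) <= g' e <= g e. *)
apply/le_anti/andP; split.
  by have := g'_le (- e) 1 ler01; rewrite scale1r addNr mul1r sublinear0// sub0r.
by have := sublinear_opp g' e sg'; have := g'g e; lra.
Qed.

(** A direction once straightened stays so: later steps only lower [g] at e and - e, while the sum
    of these two values is never negative for a sublinear function. *)
Lemma sublinear_straighten_seq (s : seq 'M[R]_(n, m)) g : sublinear g ->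
  exists g', [/\ sublinear g', forall x, g' x <= g x &
    {in s, forall e, g' e + g' (- e) <= 0}].
Proof.
elim: s g => [|e s IH] g sg; first by exists g; split.
have [g1 [sg1 le1 he]] := sublinear_straighten g e sg.
have [g2 [sg2 le2 hs]] := IH g1 sg1.
exists g2; split=> // [x|x]; first exact: le_trans (le2 x) (le1 x).
rewrite inE => /predU1P[->|/hs//].
have := le2 e; have := le2 (- e); have := le1 e; rewrite he; lra.
Qed.

(** Straightening along [x0] first pins the value at [x0]; straightening along all [delta_mx] then
    makes the function linear, because a sublinear function is additive on the subspace [lin] where
    it is odd. The matrix [y] lists its values on the standard basis. *)
Lemma sublinear_support g x0 : sublinear g ->
  exists2 y, (forall x, dotmx x y <= g x) & dotmx x0 y = g x0.
Proof.
move=> sg.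
have [g1 [sg1 le1 h1]] := sublinear_straighten g x0 sg.
have [g2 [sg2 le2 h2]] := sublinear_straighten_seq
  [seq delta_mx k.1 k.2 | k : 'I_n * 'I_m] g1 sg1.
pose lin x := g2 x + g2 (- x) <= 0.
have linN x : lin x -> g2 (- x) = - g2 x.
  by rewrite /lin; have := sublinear_opp g2 x sg2; lra.
have lin0 : lin 0 by rewrite /lin oppr0 sublinear0// addr0.
have linZ x a : lin x -> lin (a *: x).
  rewrite /lin => hx; have [a0|/ltW a0] := leP 0 a.
    by rewrite -scalerN !sg2.2// -mulrDr mulr_ge0_le0.
  have -> : a *: x = (- a) *: - x by rewrite scaleNr scalerN opprK.
  by rewrite -scalerN opprK !sg2.2 ?oppr_ge0// -mulrDr mulr_ge0_le0 ?oppr_ge0// addrC.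
have linD x y : lin x -> lin y -> lin (x + y).
  rewrite /lin opprD; have := sg2.1 x y; have := sg2.1 (- x) (- y); lra.
have sumD (I : Type) (r : seq I) (F : I -> 'M[R]_(n, m)) : (forall i, lin (F i)) ->
    lin (\sum_(i <- r) F i) /\ g2 (\sum_(i <- r) F i) = \sum_(i <- r) g2 (F i).
  move=> lF; elim: r => [|i r [IH1 IH2]]; first by rewrite !big_nil sublinear0.
  rewrite !big_cons; split; first exact: linD.
  rewrite -IH2; apply/le_anti/andP; split; first exact: sg2.1.
  have := sg2.1 (F i + \sum_(j <- r) F j) (- \sum_(j <- r) F j).
  rewrite addrK linN//; lra.
have lind (k : 'I_n * 'I_m) (a : R) : lin (a *: delta_mx k.1 k.2).
  by apply: linZ; apply: h2; apply/mapP; exists k => //; rewrite mem_enum.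
pose y : 'M[R]_(n, m) := \matrix_(i, j) g2 (delta_mx i j).
have g2y x : g2 x = dotmx x y.
  rewrite [in LHS](mx_sum_delta x).
  have [_ ->] := sumD _ (index_enum _) _ (fun k => lind k (x k.1 k.2)).
  rewrite dotmxE exchange_big pair_bigA/=; apply: eq_bigr => -[i j] _ /=.
  rewrite mxE; have [a0|/ltW a0] := leP 0 (x i j); first by rewrite sg2.2.
  rewrite -[x i j]opprK scaleNr linN ?sg2.2 ?oppr_ge0// ?mulNr//.
  exact: (lind (i, j)).
exists y => [x|]; first by rewrite -g2y (le_trans (le2 x)).
rewrite -g2y; apply/le_anti/andP; split; first exact: le_trans (le2 _) (le1 _).
have := sublinear_opp g2 x0 sg2; have := le2 (- x0); rewrite h1; lra.
Qed.

(** On the unit sphere, an upper bound of [g] makes [L] bounded and a positive lower bound puts a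
    ball around 0 into it. [sublinear_support] supplies the point of [L] at which g x is
    attained. *)
Lemma sublinear_support_fun g : sublinear g -> (forall x, x != 0 -> 0 < g x) ->
  exists2 L : set 'M[R]_(n, m), convex_body_o L & forall x, support_fun L x = g x.
Proof.
move=> sg gpos; have cg := cvx_fun_continuous g (sublinear_cvx g sg).
pose L := [set y | forall x, dotmx x y <= g x].
have vL : cvx_closed L.
  move=> x y t t0 t1 Lx Ly w; rewrite !dotmx_lin.
  have := Lx w; have := Ly w; nra.
have clL : closed L.
  have -> : L = \bigcap_(x in setT) [set y | dotmx x y <= g x].
    by apply/seteqP; split=> [y Ly x _|y Ly x]; exact: Ly.
  apply: closed_bigI => x _.
  have -> : [set y | dotmx x y <= g x] = dotmx x @^-1` [set t | t <= g x] by [].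
  by apply: closed_comp => [y _|]; [exact: continuous_dotmxr|exact: closed_le].
have [N0 N1 hN] : exists2 N, 0 <= N & forall x, enorm x = 1 -> g x <= N.
  have [M hM] : exists M, forall x : 'M[R]_(n, m), enorm x = 1 -> g x <= M.
    (* The sphere is empty when n or m is 0. *)
    have [E0|/set0P E0] := eqVneq [set x : 'M[R]_(n, m) | enorm x = 1] set0.
      by exists 0 => x x1; have : [set x : 'M[R]_(n, m) | enorm x = 1] x by []; rewrite E0.
    have [c _ hc] := compact_EVT_max E0 compact_sphere
      (continuous_subspaceT cg).
    by exists (g c) => x x1; apply: hc; rewrite inE.
  exists `|M| => // x x1; exact: le_trans (hM x x1) (ler_norm _).
have [d0 d1 hd] : exists2 d, 0 < d & forall x, enorm x = 1 -> d <= g x.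
  have [E0|/set0P E0] := eqVneq [set x : 'M[R]_(n, m) | enorm x = 1] set0.
    by exists 1 => // x x1; have : [set x : 'M[R]_(n, m) | enorm x = 1] x by []; rewrite E0.
  have [c /set_mem c1 hc] := compact_EVT_min E0 compact_sphere
    (continuous_subspaceT cg).
  exists (g c); last by move=> x x1; apply: hc; rewrite inE.
  apply: gpos; apply/eqP => c0; move: c1; rewrite /= c0 enorm0 => /esym/eqP.
  by rewrite oner_eq0.
have unit x : x != 0 -> enorm ((enorm x)^-1 *: x) = 1.
  move=> x0; rewrite enormZ ger0_norm ?invr_ge0 ?enorm_ge0// mulVf//.
  by rewrite gt_eqF// enorm_gt0.
have gd x : d0 * enorm x <= g x.
  have [->|x0] := eqVneq x 0; first by rewrite enorm0 mulr0 sublinear0.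
  have := hd _ (unit x x0); rewrite sg.2 ?invr_ge0 ?enorm_ge0//.
  by rewrite mulrC ler_pdivlMr ?enorm_gt0.
have cL : compact L.
  apply: (mx_bounded_closed_compact L N0) => // y Ly.
  apply: le_trans (ler_norm_enorm _) _.
  have [->|y0] := eqVneq y 0; first by rewrite enorm0.
  have := le_trans (Ly _) (hN _ (unit y y0)).
  rewrite dotmxZl -enorm_sq expr2 mulKf//.
  by rewrite gt_eqF// enorm_gt0.
have iL : L° 0.
  apply/nbhs_enormP; exists d0 => // y; rewrite subr0 => /ltW yd x.
  apply: le_trans (cauchy_schwarz _ _) _; apply: le_trans (gd x).
  by rewrite mulrC ler_wpM2r// enorm_ge0.
have bL : convex_body L by split=> //; [exact/convex_setP|exists 0].
exists L; first by split.
move=> x; apply/le_anti/andP; split.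
  have [k Lk ->] := support_fun_max L x cL (convex_body_nonempty L bL).
  exact: Lk.
have [y Ly <-] := sublinear_support g x sg.
exact: support_fun_ub.
Qed.

End Sublinear.

(** * The gauge of a sublevel set of a convex function *)

Section Gauge.
Context {R : realType} {n m : nat}.
Implicit Types (x y : 'M[R]_(n, m)).

(** [S x] collects s = 1/t, so [inf (S x)] is the Minkowski functional of the convex set {G <= V}.
    The last hypothesis says that this set contains no ray from the origin, which makes the
    functional positive away from 0. *)
Lemma gauge_sublinear (G : 'M[R]_(n, m) -> R) (V : R)
    (S := fun x => [set s : R | 0 < s /\ G (s^-1 *: x) <= V]) :
  cvx_fun G -> G 0 = 0 -> 0 < V ->
  (forall x, x != 0 -> exists2 t, 0 < t & V < G (t *: x)) ->
  [/\ forall x, S x !=set0, forall x, has_lbound (S x),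
    sublinear (fun x => inf (S x)) & forall x, x != 0 -> 0 < inf (S x)].
Proof.
move=> cG G0 V0 hG.
have S0 x : S x !=set0.
  have [h|h] := leP (G x) V; first by exists 1; split=> //; rewrite invr1 scale1r.
  have Gx : 0 < G x := lt_trans V0 h.
  (* By convexity and G 0 = 0, shrinking [x] by the factor V / G x < 1 brings the value down to at
     most V. *)
  exists (G x / V); split; first exact: divr_gt0.
  rewrite invf_div; apply: le_trans (cvx_fun_ray _ _ _ cG G0 _ _) _.
  - by rewrite divr_ge0// ltW.
  - by rewrite ler_pdivrMr// mul1r ltW.
  - by rewrite divfK// gt_eqF.
have Sl x : has_lbound (S x) by exists 0 => s [/ltW].
have Spos x : x != 0 -> 0 < inf (S x).
  move=> /hG[t t0 Gt]; apply: (@lt_le_trans _ _ t^-1); first by rewrite invr_gt0.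
  apply: lb_le_inf => // s [s0 Gs]; rewrite leNgt; apply/negP => st.
  have ts1 : t * s < 1 by rewrite -ltr_pdivlMl// mulr1.
  have := cvx_fun_ray _ (s^-1 *: x) (t * s) cG G0.
  rewrite scalerA mulfK ?gt_eqF// => /(_ (ltac:(by rewrite mulr_ge0// ltW)) (ltW ts1)).
  have ts0 : 0 < t * s by rewrite mulr_gt0.
  nra.
have glb x s : S x s -> inf (S x) <= s by move=> Ss; exact: ge_inf.
have hom a x : 0 < a -> inf (S (a *: x)) <= a * inf (S x).
  move=> a0; rewrite -ler_pdivrMl//; apply: lb_le_inf => // s [s0 Gs].
  rewrite ler_pdivrMl//; apply: glb; split; first exact: mulr_gt0.
  by rewrite scalerA invfM mulrAC mulVf ?gt_eqF// mul1r.
have inf0 : inf (S 0) = 0.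
  apply/le_anti/andP; split; last by apply: lb_le_inf => // s [/ltW].
  apply/ler_addgt0Pr => e e0; rewrite add0r; apply: glb; split=> //.
  by rewrite scaler0 G0 ltW.
split=> //; split=> [x y|a x].
  rewrite -lerBlDr; apply: lb_le_inf => // s [s0 Gs]; rewrite lerBlDr -lerBlDl.
  apply: lb_le_inf => // t [t0 Gt]; rewrite lerBlDl; apply: glb.
  have st0 : 0 < s + t by rewrite addr_gt0.
  (* (x + y) / (s + t) is the average of x / s and y / t with weights s / (s + t) and t / (s +
     t). *)
  split=> //; pose l := s / (s + t).
  have l0 : 0 <= l by rewrite divr_ge0// ltW.
  have l1 : l <= 1 by rewrite ler_pdivrMr// mul1r lerDl ltW.
  have -> : (s + t)^-1 *: (x + y) = l *: (s^-1 *: x) + (1 - l) *: (t^-1 *: y).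
    have -> : 1 - l = t / (s + t) by rewrite /l; field; rewrite gt_eqF.
    rewrite !scalerA scalerDr; congr (_ *: _ + _ *: _).
      by rewrite /l; field; rewrite !gt_eqF.
    by field; rewrite !gt_eqF.
  apply: le_trans (cG _ _ _ l0 l1) _; nra.
rewrite le_eqVlt => /predU1P[<-|a0]; first by rewrite scale0r mul0r.
apply/le_anti; rewrite hom//= -ler_pdivlMl//.
have := hom a^-1 (a *: x); rewrite invr_gt0 scalerA mulVf ?gt_eqF// scale1r; exact.
Qed.

End Gauge.

(** * Integration against a subadditive set function *)

Lemma subinterval_avoid {R : realType} (s : seq R) (a b : R) : a < b ->
  exists a' b', [/\ a <= a', a' < b', b' <= b & forall x, x \in s -> ~~ (a' <= x <= b')].
Proof.
elim: s => [|x s IH] ab; first by exists a, b; split.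
have [c [d [ac cd db h]]] := IH ab.
have [xl|xl] := leP x ((c + d) / 2).
  exists ((c + 3 * d) / 4), d; split=> //; [lra|lra|].
  move=> y; rewrite inE => /predU1P[->|/h]; first by apply/negP => /andP[]; lra.
  by apply: contra => /andP[h1 ->]; rewrite andbT; lra.
exists c, ((c + d) / 2); split=> //; [lra|lra|].
move=> y; rewrite inE => /predU1P[->|/h]; first by apply/negP => /andP[]; lra.
by apply: contra => /andP[-> h1]; lra.
Qed.

(** [sintegral] groups a simple function by its values, so two pieces with equal coefficients are
    merged, and a subadditive [mu] may give their union less than the sum. Distinct coefficients
    keep the pieces apart; perturbing downwards keeps the simple function below the integrand. *)
Lemma perturb_distinct {R : realType} (I : eqType) (s : seq I) (a : I -> R) (e : R) :
  uniq s -> 0 < e -> exists a' : I -> R,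
  {in s &, injective a'} /\ {in s, forall i, a i - e < a' i < a i}.
Proof.
elim: s => [|i s IH]; first by exists a.
move=> /= /andP[si us] e0; have [a' [inj_a' ha']] := IH us e0.
have [c [d [ac cd db h]]] :=
  subinterval_avoid (map a' s) (a i - e / 2) (a i - e / 4) (ltac:(lra)).
exists (fun j => if j == i then c else a' j); split; last first.
  move=> j; rewrite inE; case: eqP => [->|_ /= /ha'//]; move=> _; lra.
have cs j : j \in s -> c <> a' j.
  by move=> js ca; have := h (a' j) (map_f _ js); rewrite -ca lexx ltW.
move=> j k; rewrite !inE; case: (eqVneq j i) => [->|ji]; case: (eqVneq k i) => [->|ki] //=.
- by move=> _ ks /cs; exact.
- by move=> js _ /esym/cs; exact.
- exact: inj_a'.
Qed.

(* A set function that is merely subadditive but whose sums over disjoint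
   measurable families stay bounded: its integral, defined as a supremum over
   simple functions, is the integral against its total variation, which is
   additive.  This is what makes the integral convex below. *)
Record bounded_subadditive {d} {T : measurableType d} {R : realType}
    (mu : set T -> \bar R) (C : R) : Prop := BoundedSubadditive {
  bsub0 : mu set0 = 0%E;
  bsub_ge0 : forall A, (0 <= mu A)%E;
  bsub_le : forall A B, A `<=` B -> (mu A <= mu B)%E;
  bsubU : forall A B, (mu (A `|` B) <= mu A + mu B)%E;
  bsub_bound : forall (I : finType) (P : I -> set T),
    (forall i, measurable (P i)) -> trivIset setT P ->
    (\sum_i mu (P i) <= C%:E)%E }.

Section SubadditiveIntegral.
Context {d} {T : measurableType d} {R : realType}.
Context (mu : set T -> \bar R) (C : R) (bmu : bounded_subadditive mu C).
Context (D : set T) (mD : measurable D).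
Implicit Types (f g k : T -> R).

Import HBNNSimple.

Let m A := fine (mu A).

Lemma bsub_fin A : measurable A -> mu A = (m A)%:E.
Proof.
move=> mA; rewrite /m fineK// ge0_fin_numE ?(bsub_ge0 _ _ bmu)//.
have := bsub_bound _ _ bmu unit (fun=> A) (fun=> mA).
have tA : trivIset [set: unit] (fun=> A) by move=> [] [].
by move=> /(_ tA); rewrite big_const card_unit/= adde0 => /le_lt_trans; apply; exact: ltry.
Qed.

Let m_ge0 A : 0 <= m A.
Proof. by rewrite fine_ge0// (bsub_ge0 _ _ bmu). Qed.

Let m0 : m set0 = 0.
Proof. by rewrite /m (bsub0 _ _ bmu). Qed.

Let m_bound (I : finType) (P : I -> set T) : (forall i, measurable (P i)) ->
  trivIset setT P -> \sum_i m (P i) <= C.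
Proof.
move=> mP tP; have := bsub_bound _ _ bmu I P mP tP.
by under eq_bigr do rewrite bsub_fin//; rewrite sumEFin lee_fin.
Qed.

Lemma bsub_cover (I : finType) (P : I -> set T) A : measurable A ->
  (forall i, measurable (P i)) -> (forall x, A x -> exists i, P i x) ->
  m A <= \sum_i m (P i).
Proof.
move=> mA mP AP; rewrite -lee_fin -bsub_fin// -sumEFin.
under eq_bigr do rewrite -bsub_fin//.
apply: (@le_trans _ _ (mu (\big[setU/set0]_i P i))).
  by apply: (bsub_le _ _ bmu) => x /AP[i Pix]; rewrite (bigD1 i)//=; left.
elim/big_ind2 : _ => //; first by rewrite (bsub0 _ _ bmu).
by move=> A1 x1 A2 x2 h1 h2; apply: le_trans (bsubU _ _ bmu _ _) _; exact: leeD.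
Qed.

Lemma sintegral_fset (h : {nnsfun T >-> R}) :
  sintegral mu h = (\sum_(c : fset_set (range h)) val c * m (h @^-1` [set val c]))%:E.
Proof.
rewrite /sintegral -(fsbig_widen (range h) setT)//=; last first.
  by move=> x [_ Nfx] /=; rewrite preimage10// (bsub0 _ _ bmu) mule0.
rewrite fsbig_finite//= big_seq_fsetE/= -sumEFin.
by apply: eq_bigr => c _; rewrite bsub_fin.
Qed.

Let below f := [set h : {nnsfun T >-> R} |
  forall x, (h x)%:E <= ((EFin \o f) \_ D) x]%E.

(** The integral unfolds to a difference of two suprema, for the positive and the negative part. For
    f >= 0 on [D] the second one ranges over simple functions that vanish identically. *)
Lemma integral_subaddE f : (forall u, D u -> 0 <= f u) ->
  (\int[mu]_(u in D) (f u)%:E)%E = ereal_sup [set sintegral mu h | h in below f].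
Proof.
move=> f0; have f0' u : D u -> (0 <= (EFin \o f) u)%E by move=> Du; rewrite lee_fin f0.
rewrite /integral funepos_restrict funeneg_restrict.
have /eq_restrictP-> := ge0_funeposE f0'.
have /eq_restrictP-> := ge0_funenegE f0'.
rewrite [X in (_ - X)%E](_ : _ = 0%E) ?sube0//.
have s0 (h : {nnsfun T >-> R}) : (forall x, h x = 0) -> sintegral mu h = 0%E.
  move=> h0; rewrite sintegral_fset big1// => c _.
  case: c => c /= cP; move: (cP); rewrite in_fset_set// => /set_mem[x _ <-].
  by rewrite h0 mul0r.
apply/le_anti/andP; split.
  apply: ge_ereal_sup => _ [h hle <-]; rewrite s0// => x.
  by apply/le_anti; rewrite fun_ge0 andbT -lee_fin; have := hle x; rewrite erestrict0.
apply: ereal_sup_ubound; exists nnsfun0; last exact: s0.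
by move=> x; rewrite erestrict0.
Qed.

Lemma below_le f h : (forall u, D u -> 0 <= f u) -> below f h ->
  (forall u, D u -> h u <= f u) /\ (forall u, ~ D u -> h u = 0).
Proof.
move=> f0 hf; split=> u Du; have := hf u; rewrite /patch.
  by rewrite mem_set//= lee_fin.
rewrite memNset//= lee_fin => h0; apply/le_anti; rewrite h0/=.
exact: fun_ge0.
Qed.

(** The coefficients [a] may repeat or be negative. Small ones are dropped and the others made
    distinct, so the supremum over simple functions dominates the sum of the separate masses up to
    [e]. *)
Lemma le_subadd_integral f (I : finType) (P : I -> set T) (a : I -> R) :
  (forall u, D u -> 0 <= f u) -> (forall i, measurable (P i)) ->
  trivIset setT P -> (forall i, P i `<=` D) ->
  (forall i u, P i u -> a i <= f u) ->
  ((\sum_i a i * m (P i))%:E <= \int[mu]_(u in D) (f u)%:E)%E.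
Proof.
move=> f0 mP tP PD aP; rewrite integral_subaddE//.
apply/lee_addgt0Pr => e e0.
(* All coefficients together lose at most th times the sum of the masses, hence at most th * C <=
   e. *)
pose th := e / (`|C| + 1).
have th0 : 0 < th by rewrite divr_gt0// ltr_wpDl.
(* Above [th] the perturbed coefficients remain positive, and the value 0 is left to the complement
   of the pieces. *)
pose s := [seq i <- enum I | th < a i].
have us : uniq s by rewrite filter_uniq// enum_uniq.
have [b [inj_b hb]] := perturb_distinct I s a th us th0.
have b0 i : i \in s -> 0 < b i.
  move=> si; have := hb i si; move: si; rewrite mem_filter => /andP[h _]; lra.
pose b' i := if i \in s then b i else 0.
have b'0 i : 0 <= b' i by rewrite /b'; case: ifP => // /b0/ltW.
pose F i := scale_nnsfun (indic_nnsfun R (mP i)) (b'0 i).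
pose h := \big[add_nnsfun/nnsfun0]_(i <- s) F i.
have FE i u : F i u = b' i * (u \in P i)%:R by rewrite /= mindicE.
have hE u : h u = \sum_(i <- s) b' i * (u \in P i)%:R.
  rewrite /h; elim: (s) => [|j r IH]; first by rewrite !big_nil.
  by rewrite !big_cons -IH -FE.
have hP i u : i \in s -> P i u -> h u = b i.
  move=> si Piu; rewrite hE (bigD1_seq i)//= mem_set// mulr1 /b' si big1 ?addr0//.
  move=> j ji; case: (boolP (u \in P j)) => [/set_mem Pju|_]; last by rewrite mulr0.
  by case/negP: ji; apply/eqP; apply: tP => //; exists u.
have hN u : (forall i, i \in s -> ~ P i u) -> h u = 0.
  move=> hu; rewrite hE big_seq big1// => i si.
  by rewrite memNset ?mulr0//; exact: hu.
have hpre i : i \in s -> h @^-1` [set b i] = P i.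
  move=> si; apply/seteqP; split=> u /=; last exact: hP.
  move=> hu; apply: contrapT => Piu; have := b0 i si.
  have [[j [sj Pju]]|nj] := pselect (exists j, j \in s /\ P j u).
    by move=> _; apply: Piu; rewrite -(inj_b j i sj si (etrans (esym (hP j u sj Pju)) hu)).
  by rewrite -hu hN ?ltxx// => j sj Pj; apply: nj; exists j.
have hs : sintegral mu h = (\sum_(i <- s) b i * m (P i))%:E.
  pose S := 0 :: map b s.
  have uS : uniq S.
    rewrite /= map_inj_in_uniq// us andbT; apply/mapP => -[i si h0].
    by have := b0 i si; rewrite -h0 ltxx.
  rewrite /sintegral -(fsbig_widen [set` S] setT)//=; last first.
    move=> x [_ Sx] /=; rewrite preimage10 ?(bsub0 _ _ bmu) ?mule0//.
    move=> [u _ hu]; apply: Sx; rewrite /= -hu inE.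
    have [[j [sj Pju]]|nj] := pselect (exists j, j \in s /\ P j u).
      by rewrite (hP j)// map_f// orbT.
    by rewrite hN ?eqxx// => j sj Pj; apply: nj; exists j.
  rewrite -fsbig_seq// big_cons mul0e.
  rewrite [LHS]add0e big_map -sumEFin big_seq [RHS]big_seq.
  by apply: eq_bigr => i si; rewrite hpre// bsub_fin.
apply: (@le_trans _ _ (sintegral mu h + e%:E)%E); last first.
  rewrite leeD2r//; apply: ereal_sup_ubound; exists h => // u; rewrite /patch.
  case: ifPn => [/set_mem Du|/negP Du] /=; rewrite lee_fin.
    have [[j [sj Pju]]|nj] := pselect (exists j, j \in s /\ P j u).
      by rewrite (hP j)// (le_trans _ (aP j u Pju))//; have := hb j sj; lra.
    by rewrite hN ?f0// => j sj Pj; apply: nj; exists j.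
  by rewrite hN// => j sj /PD Du'; apply: Du; exact: mem_set.
rewrite hs -EFinD lee_fin.
apply: (@le_trans _ _ (\sum_(i <- s) b i * m (P i) + \sum_i th * m (P i))); last first.
  rewrite lerD2l -mulr_sumr; have := m_bound I P mP tP; rewrite /th => hC.
  rewrite mulrAC ler_pdivrMr ?ltr_wpDl// ler_pM2l//.
  by rewrite (le_trans hC)// (le_trans (ler_norm _))// lerDl.
have -> : \sum_(i <- s) b i * m (P i) = \sum_i (if th < a i then b i * m (P i) else 0).
  by rewrite /s big_filter big_mkcond big_enum.
rewrite -big_split; apply: ler_sum => i _ /=.
case: ifPn => [thi|]; last by rewrite -leNgt add0r => h1; rewrite ler_wpM2r.
have si : i \in s by rewrite mem_filter thi mem_enum.
by rewrite -mulrDl ler_wpM2r//; have := hb i si; lra.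
Qed.

Let J f := fine (\int[mu]_(u in D) (f u)%:E).

Let mpre (h : {nnsfun T >-> R}) c : measurable (h @^-1` [set c]).
Proof. by []. Qed.

Let tpre (h : {nnsfun T >-> R}) :
  trivIset setT (fun c : fset_set (range h) => h @^-1` [set val c]).
Proof. by move=> c c' _ _ [x [/= xc xc']]; apply: val_inj; exact: etrans (esym xc) xc'. Qed.

Lemma subadd_integral_le f B : (forall u, D u -> 0 <= f u) ->
  0 <= B -> (forall u, D u -> f u <= B) ->
  (\int[mu]_(u in D) (f u)%:E <= (B * C)%:E)%E.
Proof.
move=> f0 B0 fB; rewrite integral_subaddE//.
apply: ge_ereal_sup => _ [h hf <-]; have [h1 h2] := below_le f h f0 hf.
rewrite sintegral_fset lee_fin.
apply: (@le_trans _ _ (\sum_(c : fset_set (range h)) B * m (h @^-1` [set val c]))).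
  apply: ler_sum => -[c /= cP] _; apply: ler_wpM2r => //.
  move: cP; rewrite in_fset_set// => /set_mem[x _ <-].
  have [Dx|Dx] := pselect (D x); first by rewrite (le_trans (h1 x Dx))// fB.
  by rewrite h2.
by rewrite -mulr_sumr ler_wpM2l//; apply: m_bound (@tpre h) => c; exact: mpre.
Qed.

Lemma subadd_integral_ge0 f : (forall u, D u -> 0 <= f u) ->
  (0 <= \int[mu]_(u in D) (f u)%:E)%E.
Proof.
move=> f0; have := le_subadd_integral f unit (fun=> set0) (fun=> 0) f0
  (fun=> measurable0).
rewrite big1 => [|i _]; last by rewrite mul0r.
move=> h; apply: h => //; first (by move=> i j _ _ [x []]); by move=> i x [].
Qed.

Lemma subadd_integral_fin f B : (forall u, D u -> 0 <= f u) ->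
  0 <= B -> (forall u, D u -> f u <= B) ->
  (\int[mu]_(u in D) (f u)%:E)%E = (J f)%:E.
Proof.
move=> f0 B0 fB; rewrite /J fineK// ge0_fin_numE ?subadd_integral_ge0//.
by apply: le_lt_trans (subadd_integral_le f B f0 B0 fB) _; rewrite ltry.
Qed.

Let cell f (N : nat) (a : nat) := D `&` [set u | Num.truncn (N%:R * f u) = a].

Let cellE f N a u : (0 < N)%N -> 0 <= f u -> cell f N a u ->
  a%:R / N%:R <= f u < (a%:R + 1) / N%:R.
Proof.
move=> N0 f0 [_ /= <-]; have N0' : 0 < N%:R :> R by rewrite ltr0n.
have /truncn_itv : 0 <= N%:R * f u by rewrite mulr_ge0.
by rewrite ler_pdivrMr// ltr_pdivlMr// ![f u * _]mulrC natr1.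
Qed.

Let mcell f N a : (0 < N)%N -> measurable_fun D f -> (forall u, D u -> 0 <= f u) ->
  measurable (cell f N a).
Proof.
move=> N0 mf f0; have N0' : 0 < N%:R :> R by rewrite ltr0n.
have -> : cell f N a = D `&` f @^-1` `[a%:R / N%:R, (a%:R + 1) / N%:R[%classic.
  apply/seteqP; split=> u [Du] uP; split=> //=.
    by rewrite in_itv /=; apply: cellE => //; exact: f0.
  move: uP; rewrite /= in_itv /= ler_pdivrMr// ltr_pdivlMr// ![f u * _]mulrC natr1.
  exact: truncn_def.
exact: mf.
Qed.

(** Refine the level sets of a simple h <= k by slices of height 1/N of [f] and of [g].
    Subadditivity bounds the sum for [h] by the sum over the refinement; on each piece [h] is at
    most the convex combination of the lower slice values plus 1/N; and [le_subadd_integral] bounds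
    the lower sums by the integrals. The slicing costs C/N in total. *)
Lemma subadd_integral_convex f g k (B t : R) :
  measurable_fun D f -> measurable_fun D g ->
  0 <= B -> 0 <= t -> t <= 1 ->
  (forall u, D u -> 0 <= f u <= B) -> (forall u, D u -> 0 <= g u <= B) ->
  (forall u, D u -> 0 <= k u <= t * f u + (1 - t) * g u) ->
  J k <= t * J f + (1 - t) * J g.
Proof.
move=> mf mg B0 t0 t1 fB gB kB.
have f0 u : D u -> 0 <= f u by move=> /fB/andP[].
have g0 u : D u -> 0 <= g u by move=> /gB/andP[].
have k0 u : D u -> 0 <= k u by move=> /kB/andP[].
have kB' u : D u -> k u <= B.
  move=> Du; have := fB u Du; have := gB u Du; have := kB u Du; nra.
have JfE := subadd_integral_fin f B f0 B0 (fun u Du => (andP (fB u Du)).2).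
have JgE := subadd_integral_fin g B g0 B0 (fun u Du => (andP (gB u Du)).2).
have JkE := subadd_integral_fin k B k0 B0 kB'.
apply/ler_addgt0Pr => e e0.
pose N := (Num.truncn (`|C| / e)).+1.
have N0 : 0 < N%:R :> R by rewrite ltr0n.
have CN : C / N%:R <= e.
  rewrite ler_pdivrMr// -ler_pdivrMl// mulrC.
  apply: le_trans (ltW (truncnS_gt _)).
  by rewrite ler_wpM2r ?invr_ge0 ?ler_norm// ltW.
apply: (@le_trans _ _ (t * J f + (1 - t) * J g + C / N%:R)); last by rewrite lerD2l.
rewrite -lee_fin -JkE integral_subaddE//.
apply: ge_ereal_sup => _ [h hk <-]; have [h1 h2] := below_le k h k0 hk.
rewrite sintegral_fset lee_fin.
pose M := (Num.truncn (N%:R * B)).+1.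
have lM (f1 : T -> R) u : D u -> 0 <= f1 u <= B -> (Num.truncn (N%:R * f1 u) < M)%N.
  move=> Du /andP[f10 f1B]; rewrite /M ltnS; apply: le_truncn.
  by rewrite ler_wpM2l.
pose S : finType := fset_set (range h).
pose P (i : S * ('I_M * 'I_M)) :=
  h @^-1` [set val i.1] `&` (cell f N i.2.1 `&` cell g N i.2.2).
have mP i : measurable (P i).
  by apply: measurableI; [exact: mpre|apply: measurableI; exact: mcell].
have tP : trivIset setT P.
  move=> [c [a b]] [c' [a' b']] _ _ [x [[/= xc [[_ /= fa] [_ /= gb]]] [/= xc' [[_ /= fa']
    [_ /= gb']]]]].
  congr (_, (_, _)); apply: val_inj;
    [exact: etrans (esym xc) xc'|exact: etrans (esym fa) fa'|exact: etrans (esym gb) gb'].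
have PD i : P i `<=` D by move=> x [_ [[]]].
have Pf i u : P i u -> i.2.1%:R / N%:R <= f u < (i.2.1%:R + 1) / N%:R.
  by move=> [_ [cf [Du _]]]; apply: cellE => //; exact: f0.
have Pg i u : P i u -> i.2.2%:R / N%:R <= g u < (i.2.2%:R + 1) / N%:R.
  by move=> [_ [[Du _] cg]]; apply: cellE => //; exact: g0.
have lf : \sum_(i : S * ('I_M * 'I_M)) (i.2.1%:R / N%:R) * m (P i) <= J f.
  rewrite -lee_fin -JfE; apply: le_subadd_integral => // i u /Pf /andP[]//.
have lg : \sum_(i : S * ('I_M * 'I_M)) (i.2.2%:R / N%:R) * m (P i) <= J g.
  rewrite -lee_fin -JgE; apply: le_subadd_integral => // i u /Pg /andP[]//.
have lC := m_bound _ P mP tP.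
apply: (@le_trans _ _ (\sum_(c : S) \sum_(ab : 'I_M * 'I_M) val c * m (P (c, ab)))).
  apply: ler_sum => c _; rewrite -mulr_sumr.
  (* The level set of 0 may leave [D], where the slices do not cover it, but its term vanishes. *)
  have [c0|c0] := eqVneq (val c) 0; first by rewrite c0 !mul0r.
  apply: ler_wpM2l.
    by case: c {c0} => c /=; rewrite in_fset_set// => /set_mem[x _ <-]; exact: fun_ge0.
  apply: bsub_cover => // [u /= hu].
  have Du : D u by apply: contrapT => /h2 hu0; case/negP: c0; apply/eqP;
    exact: etrans (esym hu) hu0.
  by exists (Ordinal (lM f u Du (fB u Du)), Ordinal (lM g u Du (gB u Du))).
rewrite pair_bigA/=.
apply: (@le_trans _ _ (\sum_(i : S * ('I_M * 'I_M)) (t * ((i.2.1%:R / N%:R) * m (P i)) +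
   (1 - t) * ((i.2.2%:R / N%:R) * m (P i)) + N%:R^-1 * m (P i)))); last first.
  rewrite !big_split/= -!mulr_sumr.
  have N1 : 0 < N%:R^-1 :> R by rewrite invr_gt0.
  by apply: lerD; [apply: lerD; apply: ler_wpM2l => //; rewrite subr_ge0|
    rewrite mulrC ler_wpM2r// ltW].
apply: ler_sum => -[c [a b]] _ /=.
have [[u Pu]|nP] := pselect (exists u, P (c, (a, b)) u); last first.
  by rewrite (_ : P _ = set0) ?m0 ?mulr0 ?addr0//; rewrite -subset0 => x Px; apply: nP; exists x.
rewrite !mulrA -!mulrDl; apply: ler_wpM2r => //.
have /andP[_ fu] := Pf _ _ Pu; have /andP[_ gu] := Pg _ _ Pu.
have Du := PD _ _ Pu; have := h1 u Du; have /andP[_ ku] := kB u Du.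
have -> : h u = val c by case: Pu.
move: fu gu; rewrite /= !mulrDl !mul1r; nra.
Qed.

End SubadditiveIntegral.

(** * Hausdorff measure *)

Lemma ball_volume_gt0 {R : realType} s : 0 < @ball_volume R s.
Proof.
suff : 0 < @ball_volume R s /\ 0 < @ball_volume R s.+1 by case.
elim: s => [|s [h1 h2]]; first by rewrite /= !ltr01.
by split=> //=; rewrite mulr_gt0// divr_gt0// mulr_gt0// pi_gt0.
Qed.

Section Hausdorff.
Context {R : realType} {n : nat}.
Implicit Types (A B F : set 'cV[R]_n) (s : nat) (delta r : R).
Local Open Scope ereal_scope.

Lemma ediam_leP A r : ediam A <= r%:E <->
  (forall x y, A x -> A y -> (enorm (x - y) <= r)%R).
Proof.
split=> [h x y Ax Ay|h].
  rewrite -lee_fin; apply: le_trans h; apply: ereal_sup_ubound.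
  by exists (x, y).
by apply: ge_ereal_sup => _ [[x y] [Ax Ay] <-]; rewrite lee_fin; exact: h.
Qed.

Lemma fine_ediam A r : ediam A <= r%:E -> A !=set0 ->
  ediam A = (fine (ediam A))%:E /\ (0 <= fine (ediam A))%R.
Proof.
move=> Ar [x Ax]; have h : 0%E <= ediam A.
  by apply: ereal_sup_ubound; exists (x, x) => //=; rewrite subrr enorm0.
by rewrite fineK ?fine_ge0// ge0_fin_numE// (le_lt_trans Ar) ?ltry.
Qed.

Lemma hausdorff_weight0 s : @hausdorff_weight R n s set0 = 0.
Proof. by rewrite /hausdorff_weight; case: asboolP. Qed.

Lemma hausdorff_weightE s A : A !=set0 -> hausdorff_weight s A =
  (ball_volume s * (fine (ediam A) / 2) ^+ s)%:E.
Proof. by move=> /set0P/eqP A0; rewrite /hausdorff_weight; case: asboolP. Qed.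

(** The diameter of the empty set is [-oo], which [fine] sends to 0. *)
Lemma fine_ediam_ge0 A : (0 <= fine (ediam A))%R.
Proof.
have [->|/set0P[x Ax]] := eqVneq A set0.
  rewrite (_ : ediam set0 = -oo)//; apply/eqP; rewrite -leeNy_eq.
  by apply: ge_ereal_sup => _ [[x y] [/= []]].
rewrite fine_ge0//; apply: ereal_sup_ubound; exists (x, x) => //=.
by rewrite subrr enorm0.
Qed.

Lemma hausdorff_weight_ge0 s A : 0 <= hausdorff_weight s A.
Proof.
have [->|/set0P A0] := eqVneq A set0; first by rewrite hausdorff_weight0.
rewrite hausdorff_weightE// lee_fin mulr_ge0 ?(ltW (ball_volume_gt0 _))//.
by rewrite exprn_ge0// divr_ge0// fine_ediam_ge0.
Qed.

Lemma hausdorff_weight_le s A r : (0 <= r)%R ->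
  (forall x y, A x -> A y -> (enorm (x - y) <= r)%R) ->
  hausdorff_weight s A <= (ball_volume s * (r / 2) ^+ s)%:E.
Proof.
move=> r0 /ediam_leP Ar; have [->|/set0P A0] := eqVneq A set0.
  rewrite hausdorff_weight0 lee_fin mulr_ge0 ?(ltW (ball_volume_gt0 _))//.
  by rewrite exprn_ge0// divr_ge0.
have [e e0] := fine_ediam A r Ar A0.
rewrite hausdorff_weightE// lee_fin ler_wpM2l ?(ltW (ball_volume_gt0 _))//.
rewrite lerXn2r ?nnegrE ?divr_ge0// ler_wpM2r//.
by rewrite -lee_fin -e.
Qed.

Let gauge_weight s delta (F : set (g_sigma_algebraType [set: set 'cV[R]_n])) :=
  if `[< ediam (F : set 'cV[R]_n) <= delta%:E >] then hausdorff_weight s F else +oo.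

Let gauge_weight_ge0 s delta F : 0 <= gauge_weight s delta F.
Proof.
by rewrite /gauge_weight; case: asboolP => // _; exact: hausdorff_weight_ge0.
Qed.

(* Penalizing large sets by +oo turns the premeasure into the Caratheodory
   extension of a set function on the discrete sigma-algebra. *)
Let premeasureE s delta :
  hausdorff_premeasure s delta = mu_ext (gauge_weight s delta) :> (set 'cV[R]_n -> \bar R).
Proof.
apply/funext => A; apply/le_anti/andP; split.
  apply: le_ereal_inf_tmp => _ [F [_ AF] <-].
  have [h|/existsNP[k Fk]] := pselect (forall k, ediam (F k : set 'cV[R]_n) <= delta%:E).
    apply: ereal_inf_lbound; exists F => //.
    by apply: eq_eseriesr => k _; rewrite /gauge_weight asboolT.
  rewrite (eseries_pinfty _ (k := k)) ?leey//.
    by move=> j _; rewrite gt_eqF// (lt_le_trans _ (gauge_weight_ge0 _ _ _)).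
  by rewrite /gauge_weight asboolF.
apply: le_ereal_inf_tmp => _ [F [Fd AF] <-]; apply: ereal_inf_lbound; exists F.
  by split=> // k; exact: sub_sigma_algebra.
by apply: eq_eseriesr => k _; rewrite /gauge_weight asboolT.
Qed.

Lemma hausdorff_premeasure_ge0 s delta A : 0 <= hausdorff_premeasure s delta A.
Proof. by rewrite premeasureE; exact: mu_ext_ge0. Qed.

Lemma hausdorff_premeasure_le s delta A : (0 < delta)%R ->
  hausdorff_premeasure s delta A <= hausdorff s A.
Proof. by move=> d0; apply: ereal_sup_ubound; exists delta. Qed.

Lemma hausdorff_ge0 s A : 0 <= hausdorff s A.
Proof.
exact: le_trans (hausdorff_premeasure_ge0 s 1 A) (hausdorff_premeasure_le _ _ _ ltr01).
Qed.

Lemma hausdorff0 s : @hausdorff R n s set0 = 0.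
Proof.
apply/le_anti; rewrite hausdorff_ge0 andbT.
apply: ge_ereal_sup => _ [delta _ <-]; rewrite premeasureE mu_ext0//.
by rewrite /gauge_weight hausdorff_weight0 asboolT//; apply/ediam_leP.
Qed.

Lemma le_hausdorff s : {homo @hausdorff R n s : A B / A `<=` B >-> A <= B}.
Proof.
move=> A B AB; apply: ge_ereal_sup => _ [delta d0 <-].
apply: le_trans (hausdorff_premeasure_le _ _ _ d0).
by apply: ereal_inf_le_tmp => _ [F [Fd BF] <-]; exists F => //; split=> // x /AB/BF.
Qed.

Lemma hausdorff_sigma_subadditive s : sigma_subadditive (@hausdorff R n s).
Proof.
move=> A; apply: ge_ereal_sup => _ [delta d0 <-].
rewrite premeasureE.
apply: (le_trans (@mu_ext_sigma_subadditive _ _ _ (gauge_weight s delta)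
  (gauge_weight_ge0 s delta) A)).
apply: lee_nneseries => [k _ _|k _]; first exact: mu_ext_ge0.
by rewrite -premeasureE; exact: hausdorff_premeasure_le.
Qed.

HB.instance Definition _ s := isOuterMeasure.Build R _ (@hausdorff R n s)
  (hausdorff0 s) (hausdorff_ge0 s) (@le_hausdorff s) (hausdorff_sigma_subadditive s).

(** A set of diameter at most r / 2 cannot meet both [A] and [B], so a fine enough cover of the
    union splits into a cover of [A] and one of [B]. *)
Lemma hausdorff_metric s A B r : (0 < r)%R ->
  (forall x y, A x -> B y -> (r <= enorm (x - y))%R) ->
  hausdorff s A + hausdorff s B <= hausdorff s (A `|` B).
Proof.
move=> r0 hr; set c := hausdorff s (A `|` B).
have key d1 d2 : (0 < d1)%R -> (0 < d2)%R ->
    hausdorff_premeasure s d1 A + hausdorff_premeasure s d2 B <= c.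
  move=> d10 d20; pose d := (Num.min (Num.min d1 d2) (r / 2))%R.
  have d0 : (0 < d)%R by rewrite !lt_min d10 d20 divr_gt0.
  apply: le_trans (hausdorff_premeasure_le s d _ d0).
  apply: le_ereal_inf_tmp => _ [F [Fd ABF] <-].
  pose FA k := if `[< F k `&` A !=set0 >] then F k else set0.
  pose FB k := if `[< F k `&` B !=set0 >] then F k else set0.
  apply: (@le_trans _ _ (\sum_(0 <= k <oo) hausdorff_weight s (FA k) +
      \sum_(0 <= k <oo) hausdorff_weight s (FB k))).
    have small d' G k (P : Prop) : (d <= d')%R ->
        G = (if `[< P >] then F k else set0) -> ediam G <= d'%:E.
      move=> dd' ->; case: asboolP => _; last by apply/ediam_leP.
      by rewrite (le_trans (Fd k))// lee_fin.
    apply: leeD; apply: ereal_inf_lbound; [exists FA|exists FB] => //; split.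
    - by move=> k; apply: (small _ _ k _ _ erefl); rewrite /d !ge_min lexx.
    - move=> x Ax; have [k _ Fkx] := ABF x (or_introl Ax); exists k => //.
      by rewrite /FA asboolT//; exists x.
    - by move=> k; apply: (small _ _ k _ _ erefl); rewrite /d !ge_min lexx orbT.
    - move=> x Bx; have [k _ Fkx] := ABF x (or_intror Bx); exists k => //.
      by rewrite /FB asboolT//; exists x.
  rewrite -nneseriesD; try by move=> k _ _; exact: hausdorff_weight_ge0.
  apply: lee_nneseries => [k _ _|k _].
    by apply: adde_ge0; exact: hausdorff_weight_ge0.
  rewrite /FA /FB; case: asboolP => [[x [Fx Ax]]|_]; last first.
    rewrite hausdorff_weight0 add0e; case: asboolP => // _.
    by rewrite hausdorff_weight0 hausdorff_weight_ge0.
  case: asboolP => [[y [Fy By]]|_]; last by rewrite hausdorff_weight0 adde0.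
  have := (ediam_leP _ _).1 (Fd k) x y Fx Fy; have := hr x y Ax By.
  have : (d <= r / 2)%R by rewrite ge_min lexx orbT.
  by move=> h1 h2 h3; exfalso; lra.
have [->|coo] := eqVneq c +oo; first exact: leey.
have finp d1 S : (0 < d1)%R -> S = A \/ S = B -> hausdorff_premeasure s d1 S \is a fin_num.
  move=> d10 hS; rewrite ge0_fin_numE ?hausdorff_premeasure_ge0//.
  apply: (@le_lt_trans _ _ c); last by rewrite ltey.
  apply: le_trans (hausdorff_premeasure_le _ _ _ d10) _.
  by apply: le_hausdorff; case: hS => ->; [exact: subsetUl|exact: subsetUr].
have finA : hausdorff s A \is a fin_num.
  rewrite ge0_fin_numE ?hausdorff_ge0// (le_lt_trans (y := c))// ?ltey//.
  by apply: le_hausdorff; exact: subsetUl.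
rewrite -leeBrDl//; apply: ge_ereal_sup => _ [d2 d20 <-].
rewrite leeBrDl// -leeBrDr ?finp//; last by right.
apply: ge_ereal_sup => _ [d1 d10 <-]; rewrite leeBrDr; first exact: key.
by apply: finp => //; right.
Qed.

End Hausdorff.

(** * Metric outer measures *)

Section MetricOuterMeasure.
Context {R : realType} {n m : nat}.
Context (mu : {outer_measure set 'M[R]_(n, m) -> \bar R}).
Implicit Types (A B C X : set 'M[R]_(n, m)) (r : R).
Local Open Scope ereal_scope.

Definition separated A B := exists2 r : R, (0 < r)%R &
  forall x y, A x -> B y -> (r <= enorm (x - y))%R.

Context (mu_metric : forall A B, separated A B -> mu A + mu B <= mu (A `|` B)).

Section Layers.
Context (C X : set 'M[R]_(n, m)).

Let away k := [set x | X x /\ forall y, C y -> ((k.+1%:R)^-1 <= enorm (x - y))%R].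
Let layer k := away k.+1 `\` away k.

Let away_le k l : (k <= l)%N -> away k `<=` away l.
Proof.
move=> kl x [Xx h]; split=> // y Cy; apply: le_trans (h y Cy).
by rewrite lef_pV2 ?posrE ?ltr0n// ler_nat ltnS.
Qed.

(** A point of [layer l] is not in [away l], hence closer than 1 / (l + 1) to [C], whereas points of
    [away k] keep the distance 1 / (k + 1). *)
Let away_layer k l : (k < l)%N -> separated (away k) (layer l).
Proof.
move=> kl; exists ((k.+1%:R)^-1 - (l.+1%:R)^-1)%R.
  by rewrite subr_gt0 ltf_pV2 ?posrE ?ltr0n// ltr_nat ltnS.
move=> x z [Xx hx] [[Xz _] hz].
have [y Cy zy] : exists2 y, C y & (enorm (z - y) < (l.+1%:R)^-1)%R.
  apply: contrapT => hy; apply: hz; split=> // y Cy; rewrite leNgt.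
  by apply/negP => zy; apply: hy; exists y.
rewrite lerBlDr; apply: le_trans (hx y Cy) _.
have := ler_enormD (x - z) (z - y); rewrite addrA subrK => /le_trans; apply.
by rewrite lerD2l ltW.
Qed.

(** Neighbouring layers may touch, so only every second one is summed; [p] is used with the values 0
    and 1. *)
Let layer_sum N p : \sum_(i < N) mu (layer (i.*2 + p)) <= mu X.
Proof.
suff h : \sum_(i < N) mu (layer (i.*2 + p)) <=
    mu (\bigcup_(i < N) layer (i.*2 + p)).
  by apply: le_trans h _; apply: le_outer_measure => x [i _ [[]]].
elim: N => [|N IH]; first by rewrite big_ord0 outer_measure_ge0.
rewrite big_ord_recr/=; apply: le_trans (leeD2r _ IH) _.
apply: (@le_trans _ _ (mu ((\bigcup_(i < N) layer (i.*2 + p)) `|` layer (N.*2 + p)))).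
  case: N {IH} => [|N].
    rewrite bigcup_mkord big_ord0 outer_measure0 add0e.
    by apply: le_outer_measure; right.
  apply: mu_metric; have [r r0 hr] :=
    away_layer (N.*2 + p).+1 (N.+1.*2 + p) (ltac:(by rewrite doubleS !addSn)).
  exists r => // x y [i /= iN [xi _]]; apply: hr; apply: away_le xi.
  by rewrite ltnS leq_add2r leq_double.
apply: le_outer_measure => x [[i iN ix]|Nx]; first by exists i => //=; rewrite ltnS ltnW.
by exists N => /=.
Qed.

(** Caratheodory's criterion. The two parities give a convergent series of layer masses, and the
    part of [X] off the closed set [C] exceeds [away k] by at most a tail of this series, while
    [away k] is separated from [C]. *)
Lemma caratheodory_metric_le : closed C -> mu (X `&` C) + mu (X `&` ~` C) <= mu X.
Proof.
move=> clC; have [->|Xoo] := eqVneq (mu X) +oo; first exact: leey.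
have finX A : A `<=` X -> mu A \is a fin_num.
  move=> AX; rewrite ge0_fin_numE ?outer_measure_ge0//.
  by rewrite (le_lt_trans (le_outer_measure mu _ _ AX))// ltey.
have away_sub k : mu (X `&` C) + mu (away k) <= mu X.
  apply: le_trans (mu_metric _ _ _) _; last by apply: le_outer_measure => x [[]|[]].
  exists (k.+1%:R)^-1%R => // x y [_ Cx] [_ h].
  by rewrite enormB h.
have sum_fin : \sum_(i <oo) mu (layer i) < +oo.
  apply: (@le_lt_trans _ _ (mu X + mu X)); last by rewrite lte_add_pinfty// ltey.
  apply: lime_le; first by apply: is_cvg_nneseries => *; exact: outer_measure_ge0.
  apply: nearW => N.
  apply: (@le_trans _ _ (\sum_(0 <= i < N.*2) mu (layer i))).
    rewrite [leRHS](big_cat_nat (n := N))//= -?addnn ?leq_addr//.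
    rewrite leeDl// sume_ge0// => *; exact: outer_measure_ge0.
  have -> : \sum_(0 <= i < N.*2) mu (layer i) =
      \sum_(i < N) mu (layer (i.*2 + 0)) + \sum_(i < N) mu (layer (i.*2 + 1)).
    elim: N => [|N IH]; first by rewrite big_geq// !big_ord0 adde0.
    by rewrite doubleS !big_nat_recr//= IH !big_ord_recr/= addn0 addn1 -!addeA; congr (_ + _);
      rewrite addeCA.
  by apply: leeD; exact: layer_sum.
have tail := nneseries_tail_cvg (P := xpredT) sum_fin (fun k _ => outer_measure_ge0 mu _).
have XC k : mu (X `&` ~` C) <= mu (away k) + \sum_(k <= i <oo) mu (layer i).
  apply: le_trans (leeD2l _ (outer_measure_sigma_subadditive_tail mu k layer)).
  apply: le_trans (outer_measureU2 mu _ _); apply: le_outer_measure => x [Xx Cx].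
  have [j xj] : exists j, away j x.
    have : nbhs x (~` C) by apply: open_nbhs_nbhs; split=> //; exact: closed_openC.
    move=> /nbhs_enormP[r r0 hr].
    exists (Num.truncn r^-1); split=> // y Cy; rewrite leNgt; apply/negP => xy.
    apply: (hr y) => //; rewrite enormB (lt_trans xy)// invf_plt ?posrE ?ltr0n//.
    exact: truncnS_gt.
  have [xk|xk] := pselect (away k x); [by left|right].
  have [jk|kj] := leqP j k; first by case: xk; exact: away_le xj.
  elim: j kj xj => // j IH; rewrite ltnS => kj xj.
  have [xj'|xj'] := pselect (away j x); last by exists j => //=; rewrite ltnNge kj.
  move: kj; rewrite leq_eqVlt => /predU1P[kj|kj]; first by rewrite -kj in xj'.
  exact: IH.
apply/lee_addgt0Pr => e e0.
have [k hk] : exists k, \sum_(k <= i <oo) mu (layer i) <= e%:E.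
  have /fine_cvgP[_ /cvgrPdist_le/(_ _ e0)] := tail.
  move=> [K _ hK]; exists K; have := hK K (leqnn K); rewrite /= sub0r normrN => h.
  have s0 : 0 <= \sum_(K <= i <oo) mu (layer i) by apply: nneseries_ge0 => *;
    exact: outer_measure_ge0.
  have sf : \sum_(K <= i <oo) mu (layer i) \is a fin_num.
    rewrite ge0_fin_numE//; apply: le_lt_trans sum_fin.
    rewrite [leRHS](nneseries_split _ K); last by move=> *; exact: outer_measure_ge0.
    by rewrite add0n leeDr// sume_ge0// => *; exact: outer_measure_ge0.
  by rewrite -(fineK sf) lee_fin (le_trans (ler_norm _)).
apply: le_trans (leeD2l _ (XC k)) _; rewrite addeA; apply: leeD => //.
Qed.

End Layers.

Lemma caratheodory_closed C : closed C -> mu.-caratheodory C.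
Proof.
by move=> cC; apply: le_caratheodory_measurable => X; exact: caratheodory_metric_le.
Qed.

Lemma caratheodory_borel A : <<s @open 'M[R]_(n, m) >> A -> mu.-caratheodory A.
Proof.
apply: smallest_sub; last first.
  move=> O oO; rewrite -(setCK O); apply: caratheodory_measurable_setC.
  by apply: caratheodory_closed; exact: open_closedC.
split.
- exact: caratheodory_measurable_set0.
- by move=> B mB; rewrite setTD; exact: caratheodory_measurable_setC.
- by move=> F mF; exact: caratheodory_measurable_bigcup.
Qed.

(** The pieces are split off one at a time by Caratheodory measurability. The form is that of
    [bsub_bound]. *)
Lemma borel_sum_le (I : finType) (P : I -> set 'M[R]_(n, m)) :
  (forall i, <<s @open 'M[R]_(n, m) >> (P i)) -> trivIset setT P ->
  \sum_i mu (P i) <= mu setT.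
Proof.
move=> mP tP.
suff h s : uniq s -> \sum_(i <- s) mu (P i) <= mu [set x | exists2 i, i \in s & P i x].
  by apply: le_trans (h _ (index_enum_uniq I)) _; exact: le_outer_measure.
elim: s => [|i s IH] /=; first by rewrite big_nil outer_measure_ge0.
move=> /andP[si us]; rewrite big_cons.
rewrite (caratheodory_borel (P i) (mP i) [set x | _]).
apply: leeD.
  by apply: le_outer_measure => x Px; split=> //; exists i => //; rewrite mem_head.
apply: le_trans (IH us) _; apply: le_outer_measure => x [j sj Pj]; split.
  by exists j => //; rewrite inE sj orbT.
move=> Pi; case/negP: si; rewrite (tP i j)//; exists x; split=> //.
Qed.

End MetricOuterMeasure.

(** * Averaging over levels and covers by boxes *)

Section Averaging.
Context {R : realType}.
Local Open Scope ereal_scope.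

(** Integrate the hypothesis over [lo, hi]: the k-th term contributes at most c k times the length
    of [a k, b k]. This serves both the induction on the dimension in [box_cover] and Eilenberg's
    inequality. *)
Lemma averaging (c a b : nat -> R) (lo hi M : R) : (lo <= hi)%R -> (0 <= M)%R ->
  (forall k, (0 <= c k)%R) -> (forall k, (a k <= b k)%R) ->
  (forall s, (lo <= s <= hi)%R ->
    M%:E <= \sum_(0 <= k <oo) (c k * (a k <= s <= b k)%R%:R)%:E) ->
  (M * (hi - lo))%:E <= \sum_(0 <= k <oo) (c k * (b k - a k))%:E.
Proof.
move=> lohi M0 c0 ab h.
pose leb := @lebesgue_measure R; pose D := `[lo, hi]%classic : set R.
have mD : measurable D by exact: measurable_itv.
pose f k (s : R) := (c k * (a k <= s <= b k)%R%:R)%:E.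
have fE k : f k = (fun s => (c k)%:E * (\1_(`[a k, b k]%classic) s)%:E).
  apply/funext => s; rewrite /f EFinM indicE; congr (_ * (_%:R)%:E).
  have -> // : (s \in `[a k, b k]%classic) = (a k <= s <= b k)%R.
  by apply/idP/idP => [/set_mem|h1]; [|apply/mem_set]; rewrite /= in_itv.
have lebE (x y : R) : (x <= y)%R -> lebesgue_measure `[x, y]%classic = (y - x)%:E.
  move=> xy; rewrite lebesgue_measure_itv/= lte_fin.
  by case: ltgtP xy => // -> _; rewrite subrr.
have f0 k s : 0 <= f k s by rewrite lee_fin mulr_ge0.
have mf k : measurable_fun D (f k).
  by rewrite fE; apply/measurable_EFinP/measurable_funM => //.
have leM : \int[leb]_(s in D) (M%:E) <= \int[leb]_(s in D) (\sum_(0 <= k <oo) f k s).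
  apply: ge0_le_integral => //.
  apply: (@ge0_emeasurable_sum _ _ _ D f xpredT) => [k s _ _|k _]; first exact: f0.
  exact: mf.
have -> : (M * (hi - lo))%:E = \int[leb]_(s in D) (M%:E).
  by rewrite integral_cst// EFinM; congr (_ * _); apply/esym; exact: lebE.
apply: le_trans leM _; rewrite integral_nneseries//.
apply: lee_nneseries => [k _ _|k _]; first by apply: integral_ge0.
rewrite fE ge0_integralZl//; last 2 first.
- by apply/measurable_EFinP/measurable_indic.
- by rewrite lee_fin.
rewrite EFinM lee_wpmul2l ?lee_fin//.
rewrite integral_indic//.
apply: (@le_trans _ _ (leb `[a k, b k]%classic)).
  by apply: le_measure => //; apply/mem_set => //; apply: measurableI.
by rewrite -(lebE _ _ (ab k)).
Qed.

(** Induction on the dimension by slicing at the last coordinate; the flag [e] marks the boxes that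
    the slice meets. Points are sequences, so that N can vary without a change of type. *)
Lemma box_cover N (e : nat -> bool) (a b : nat -> nat -> R) (lo r : R) :
  (0 <= r)%R -> (forall k i, (a k i <= b k i)%R) ->
  (forall x : nat -> R, (forall i, (i < N)%N -> (lo <= x i <= lo + r)%R) ->
    exists k, e k /\ forall i, (i < N)%N -> (a k i <= x i <= b k i)%R) ->
  (r ^+ N)%:E <= \sum_(0 <= k <oo) ((e k)%:R * \prod_(i < N) (b k i - a k i))%:E.
Proof.
move=> r0 ab; elim: N e => [|N IH] e cov.
  have [k [ek _]] := cov (fun=> 0%R) (ltac:(by [])).
  rewrite expr0 (nneseriesD1 (n := k))//; last by move=> i _;
    rewrite big_ord0 mulr1 lee_fin ler0n.
  rewrite ek big_ord0 mulr1 leeDl//; apply: nneseries_ge0 => i _ _.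
  by rewrite big_ord0 mulr1 lee_fin ler0n.
have p0 k : (0 <= (e k)%:R * \prod_(i < N) (b k i - a k i))%R.
  by rewrite mulr_ge0// prodr_ge0// => i _; rewrite subr_ge0.
have -> : (r ^+ N.+1)%:E = (r ^+ N * (lo + r - lo))%:E.
  by rewrite addrAC subrr add0r exprSr.
apply: le_trans (averaging (fun k => ((e k)%:R * \prod_(i < N) (b k i - a k i))%R)
  (fun k => a k N) (fun k => b k N) _ _ _ _ _ p0 _ _) _ => //.
- by rewrite lerDl.
- exact: exprn_ge0.
- move=> s hs; apply: le_trans (IH (fun k => e k && (a k N <= s <= b k N)%R) _) _.
    move=> x hx; have [i|k [ek hk]] := cov (fun i => if i == N then s else x i).
      by case: eqP => [_ _|/eqP iN]; rewrite // ltnS leq_eqVlt (negPf iN) => /hx.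
    exists k; split.
      by rewrite ek; have := hk N (ltnSn N); rewrite eqxx.
    by move=> i iN; have := hk i (ltnW iN); rewrite ltn_eqF.
  apply: lee_nneseries => [k _ _|k _].
    by rewrite lee_fin mulr_ge0// prodr_ge0// => i _; rewrite subr_ge0.
  by rewrite lee_fin; case: (e k); case: (_ <= _ <= _)%R; rewrite /= ?mul1r ?mul0r ?mulr1 ?mulr0.
- apply: lee_nneseries => [k _ _|k _]; first by rewrite lee_fin mulr_ge0// subr_ge0.
  by rewrite big_ord_recr/= mulrA.
Qed.

(** [averaging] takes a real bound, whereas a premeasure may be infinite; it is therefore compared
    through the reals below it. *)
Lemma lee_real (x y : \bar R) : 0 <= x ->
  (forall M : R, (0 <= M)%R -> M%:E <= x -> M%:E <= y) -> x <= y.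
Proof.
case: x => [r||] x0 h; [exact: h| |by rewrite leeNy_eq in x0].
rewrite leye_eq; apply/eqP/eqyP => M M0; apply: h (ltW M0) _; exact: leey.
Qed.

End Averaging.

(** * Two-sided bounds on the volume *)

Section Volume.
Context {R : realType} {n : nat}.
Implicit Types (K : set 'cV[R]_n).
Local Open Scope ereal_scope.

(** Vectors continued by 0 to sequences, the format of [box_cover]. *)
Let seqc (v : 'cV[R]_n) (i : nat) : R := if insub i is Some j then v j 0%R else 0%R.

Lemma volume_ge K (r : R) : (0 <= r)%R ->
  (forall x : 'cV[R]_n, (forall i, (`|x i 0| <= r)%R) -> K x) ->
  ((2 * r) ^+ n)%:E <= volume K.
Proof.
move=> r0 rK; apply: le_ereal_inf_tmp => _ [[a b] [/= ab cov] <-].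
have seqcE (v : 'cV[R]_n) (j : 'I_n) : seqc v j = v j 0%R.
  by rewrite /seqc valK.
apply: (le_trans (box_cover n xpredT (fun k => seqc (a k)) (fun k => seqc (b k)) (- r) (2
  * r) _ _ _)).
- by rewrite mulr_ge0.
- by move=> k i; rewrite /seqc; case: insubP => // j _ _.
- move=> x hx; have [|k _ hk] := cov (\col_i x i).
    apply: rK => i; rewrite mxE ler_norml; have := hx i (ltn_ord i); lra.
  exists k; split=> // i ilt; have := hk (Ordinal ilt); rewrite mxE /=.
  by rewrite -!seqcE.
apply: lee_nneseries => [k _ _|k _].
  by rewrite lee_fin mul1r prodr_ge0// => i _; rewrite !seqcE subr_ge0.
by rewrite mul1r lee_fin ler_prod// => i _; rewrite !seqcE subr_ge0 ab lexx.
Qed.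

Lemma volume_lty K (M : R) : (0 < n)%N -> (0 <= M)%R ->
  (forall x, K x -> forall i, (`|x i 0| <= M)%R) -> volume K < +oo.
Proof.
move=> n0 M0 KM.
(* One large box followed by degenerate ones, whose volume is 0 because n > 0; an empty product
   would be 1. *)
pose a k : 'cV[R]_n := if k is 0%N then const_mx (- M)%R else 0%R.
pose b k : 'cV[R]_n := if k is 0%N then const_mx M else 0%R.
apply: (@le_lt_trans _ _ (\sum_(0 <= k <oo) (\prod_(i < n) (b k i 0 - a k i 0)%R)%:E)).
  apply: ereal_inf_lbound; exists (a, b) => //; split=> /= [k i|x Kx].
    by case: k => [|k] /=; rewrite !mxE//; lra.
  by exists 0%N => // i; rewrite /= !mxE -ler_norml KM.
have nn k : 0 <= (\prod_(i < n) (b k i 0 - a k i 0)%R)%:E.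
  by rewrite lee_fin prodr_ge0// => i _; case: k => [|k]; rewrite !mxE; lra.
rewrite nneseries_recl// eseries0 ?adde0 ?ltry// => -[//|k] _ _.
by rewrite (bigD1 (Ordinal n0))//= !mxE subrr mul0r.
Qed.

End Volume.

(** * Parallel sets *)

Section FiniteCover.
Context {R : realType} {n : nat}.
Implicit Types (A : set 'cV[R]_n).
Local Open Scope ereal_scope.

(** The finite cover is continued by empty sets, which have weight 0 in every dimension. *)
Lemma hausdorff_premeasure_fin s (delta : R) A (I : finType) (G : I -> set 'cV[R]_n) :
  (0 <= delta)%R -> (forall i, ediam (G i) <= delta%:E) ->
  (forall x, A x -> exists i, G i x) ->
  hausdorff_premeasure s delta A <= \sum_i hausdorff_weight s (G i).
Proof.
move=> d0 Gd AG; pose F k :=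
  if @idP (k < #|I|)%N is ReflectT h then G (enum_val (Ordinal h)) else set0.
have FE (i : 'I_#|I|) : F i = G (enum_val i).
  rewrite /F; case: {-}_ / idP => [h|]; last by move: (ltn_ord i).
  by congr (G (enum_val _)); apply: val_inj.
have F0 k : (#|I| <= k)%N -> F k = set0.
  by rewrite /F; case: {-}_ / idP => // h; rewrite leqNgt h.
apply: (@le_trans _ _ (\sum_(0 <= k <oo) hausdorff_weight s (F k))).
  apply: ereal_inf_lbound; exists F => //; split=> [k|x /AG[i Gix]].
    by rewrite /F; case: {-}_ / idP => // _; apply/ediam_leP.
  by exists (enum_rank i) => //; rewrite FE enum_rankK.
rewrite (nneseries_split _ #|I|); last by move=> k _; exact: hausdorff_weight_ge0.
rewrite add0n [X in _ + X]eseries0 ?adde0; last first.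
  by move=> k hk _; rewrite F0// hausdorff_weight0.
rewrite big_mkord; under eq_bigr do rewrite FE.
by rewrite [leRHS](reindex (@enum_val I predT))//; exact/onW_bij/enum_val_bij.
Qed.

(** The cube is cut into N^n cells of diameter at most L / N. Their weights add up to [B], which
    depends neither on N nor on [delta]. *)
Lemma hausdorff_bounded A (M : R) : (0 < M)%R ->
  (forall x, A x -> forall i, (`|x i 0%R| < M)%R) -> hausdorff n A < +oo.
Proof.
move=> M0 AM; pose B := (ball_volume n * ((1 * n).+1%:R * M) ^+ n)%R.
apply: (@le_lt_trans _ _ B%:E); last exact: ltry.
apply: ge_ereal_sup => _ [delta d0 <-].
pose L := ((1 * n).+1%:R * (2 * M))%R.
have L0 : (0 < L)%R by rewrite mulr_gt0// mulr_gt0.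
pose N := (Num.truncn (L / delta)).+1.
have N0 : (0 < N%:R :> R)%R by rewrite ltr0n.
have LN : (L / N%:R <= delta)%R.
  by rewrite ler_pdivrMr// mulrC -ler_pdivrMr// ltW// truncnS_gt.
pose c (x : 'cV[R]_n) i := Num.truncn ((x i 0%R + M) / (2 * M) * N%:R).
pose G (f : {ffun 'I_n -> 'I_N}) :=
  [set x : 'cV[R]_n | forall i, (`|x i 0%R| < M)%R /\ c x i = f i].
have Gd f x y : G f x -> G f y -> (enorm (x - y) <= L / N%:R)%R.
  move=> Gx Gy; rewrite /L -mulrA; apply: ler_enorm_coord.
    by rewrite divr_ge0// mulr_ge0// ltW.
  move=> i j; rewrite (ord1 j) !mxE.
  have [xM xc] := Gx i; have [yM yc] := Gy i; move: xc yc; rewrite /c => xc yc.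
  have itv (t : R) : (`|t| < M)%R -> 
      (let a := ((t + M) / (2 * M) * N%:R)%R in (Num.truncn a)%:R <= a < (Num.truncn a).+1%:R)%R.
    move=> tM; apply: truncn_itv; rewrite mulr_ge0// divr_ge0//.
      by move: tM; rewrite ltr_norml; lra.
    by rewrite mulr_ge0// ltW.
  have := itv _ xM; have := itv _ yM; rewrite /= xc yc -natr1.
  set a := (f i)%:R; set X := ((x i 0%R + M) / (2 * M) * N%:R)%R.
  set Y := ((y i 0%R + M) / (2 * M) * N%:R)%R.
  have -> : (x i 0%R - y i 0%R = (X - Y) * (2 * M / N%:R))%R.
    by rewrite /X /Y; field; rewrite !gt_eqF.
  have Q0 : (0 <= 2 * M / N%:R)%R by rewrite divr_ge0// mulr_ge0// ltW.
  move=> h1 h2; rewrite normrM (ger0_norm Q0) ler_piMl//.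
  by rewrite ltW// ltr_norml; lra.
apply: le_trans (hausdorff_premeasure_fin n delta A _ G (ltW d0) _ _) _.
- by move=> f; apply/ediam_leP => x y Gx Gy; exact: le_trans (Gd f x y Gx Gy) LN.
- move=> x Ax; have cN i : (c x i < N)%N.
    rewrite /c; rewrite truncn_lt_nat.
      rewrite -[ltRHS]mul1r ltr_pM2r// ltr_pdivrMr ?mulr_gt0// mul1r.
      by have := AM x Ax i; rewrite ltr_norml; lra.
    rewrite mulr_ge0// divr_ge0//; last by rewrite mulr_ge0// ltW.
    by have := AM x Ax i; rewrite ltr_norml; lra.
  exists [ffun i => Ordinal (cN i)] => i; rewrite ffunE/=; split=> //.
  exact: AM.
apply: (@le_trans _ _ (\sum_(f : {ffun 'I_n -> 'I_N}) (ball_volume n * (L / N%:R / 2) ^+ n)%:E)).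
  apply: lee_sum => f _; apply: hausdorff_weight_le; first by rewrite divr_ge0// ltW.
  exact: Gd.
rewrite sumEFin lee_fin sumr_const card_ffun !card_ord -[leLHS]mulr_natl mulrCA.
rewrite /B ler_wpM2l ?(ltW (ball_volume_gt0 _))//.
rewrite natrX -exprMn (_ : N%:R * _ = (1 * n).+1%:R * M)%R//.
by rewrite /L; field; rewrite gt_eqF.
Qed.

End FiniteCover.

Section Parallel.
Context {R : realType} {n : nat}.
Context (K : set 'cV[R]_n).
Implicit Types (p q u w : 'cV[R]_n) (s : R) (A B : set 'cV[R]_n).

(* The normal cone is monotone, so the coordinates [p] and [s *: u] of
   [p + s *: u] are 1-Lipschitz. *)
Lemma parallel_dist p p' u u' s s' : K p -> K p' ->
  outer_unit_normal K p u -> outer_unit_normal K p' u' -> 0 <= s -> 0 <= s' ->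
  let d := enorm (p + s *: u - (p' + s' *: u')) in
  [/\ enorm (p - p') <= d, enorm (s *: u - s' *: u') <= d & `|s - s'| <= d].
Proof.
move=> Kp Kp' [u1 hu] [u1' hu'] s0 s0' d.
have {}u1 : enorm u = 1 := u1; have {}u1' : enorm u' = 1 := u1'.
pose v := p - p'; pose w := s *: u - s' *: u'.
(* Both s * u.(p - p') and s' * u'.(p' - p) are nonnegative, by the normality of [u] at [p] and of
   [u'] at [p']. *)
have vw : 0 <= dotmx v w.
  rewrite /v /w dotmxC; have := hu p' Kp'; have := hu' p Kp; rewrite !dotmx_lin; nra.
have dE : d = enorm (v + w).
  by congr enorm; apply/matrixP => i j; rewrite !mxE; ring.
have wd : enorm w <= d by rewrite dE addrC; apply: ler_enorm_acute; rewrite dotmxC.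
split=> //; first by rewrite dE; exact: ler_enorm_acute.
apply: le_trans wd.
have e1 : enorm (s *: u) = s by rewrite enormZ u1 mulr1 ger0_norm.
have e2 : enorm (s' *: u') = s' by rewrite enormZ u1' mulr1 ger0_norm.
have := ler_enormD w (s' *: u'); have := ler_enormD (- w) (s *: u).
rewrite enormN /w opprB !subrK e1 e2 ler_norml; lra.
Qed.

(** The part over [A] of the shell at distance 1 to 2 from [K]. The lower end 1 keeps distinct
    normals apart, and the length 1 of the range makes averaging over [s] free of a further
    constant. *)
Definition parallel_set A : set 'cV[R]_n :=
  [set q | exists p u s, [/\ bdry K p, A u, outer_unit_normal K p u, 1 <= s <= 2 &
    q = p + s *: u]].

Definition parallel_measure A := hausdorff n (parallel_set A).

Lemma parallel_set_bigcup (F : nat -> set 'cV[R]_n) :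
  parallel_set (\bigcup_k F k) = \bigcup_k parallel_set (F k).
Proof.
apply/seteqP; split=> [_ [p [u [s [Kp [k _ Fu] Kpu s12 ->]]]]|_ [k _ [p [u [s [Kp Fu Kpu
  s12 ->]]]]]].
  by exists k => //; exists p, u, s.
by exists p, u, s; split=> //; exists k.
Qed.

Lemma parallel_setS A B : A `<=` B -> parallel_set A `<=` parallel_set B.
Proof.
by move=> AB _ [p [u [s [Kp Au Kpu s12 ->]]]]; exists p, u, s; split=> //; exact: AB.
Qed.

Lemma parallel_measure0 : parallel_measure set0 = 0%E.
Proof.
rewrite /parallel_measure (_ : parallel_set _ = set0) ?hausdorff0//.
by rewrite -subset0 => q [p [u [s [_ []]]]].
Qed.

Lemma parallel_measure_ge0 A : (0 <= parallel_measure A)%E.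
Proof. exact: hausdorff_ge0. Qed.

Lemma le_parallel_measure : {homo parallel_measure : A B / A `<=` B >-> (A <= B)%E}.
Proof. by move=> A B AB; apply: le_hausdorff; exact: parallel_setS. Qed.

Lemma parallel_measure_sigma_subadditive : sigma_subadditive parallel_measure.
Proof.
move=> F; rewrite /parallel_measure parallel_set_bigcup.
exact: hausdorff_sigma_subadditive.
Qed.

HB.instance Definition _ := isOuterMeasure.Build R _ parallel_measure
  parallel_measure0 parallel_measure_ge0 le_parallel_measure
  parallel_measure_sigma_subadditive.

Context (clK : closed K).

Let bdryK p : bdry K p -> K p.
Proof. by move=> [+ _]; rewrite -(closure_id K).1. Qed.

(** As s >= 1, |u - u'| <= |s u - s u'| <= |s u - s' u'| + |s - s'|. Both summands are at most the
    distance of the two points of the shell, whence the gap r / 2. *)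
Lemma parallel_measure_metric A B : separated A B ->
  (parallel_measure A + parallel_measure B <= parallel_measure (A `|` B))%E.
Proof.
move=> [r r0 hr].
have h2 : 0 < r / 2 by rewrite divr_gt0.
apply: le_trans (hausdorff_metric n _ _ _ h2 _) _.
  move=> _ _ [p [u [s [/bdryK Kp Au Kpu /andP[s1 _] ->]]]] [p' [u' [s' [/bdryK Kp' Bu
    Kpu' /andP[s1' _] ->]]]].
  have s0 : 0 <= s by lra.
  have s0' : 0 <= s' by lra.
  have [_ h3 h4] := parallel_dist p p' u u' s s' Kp Kp' Kpu Kpu' s0 s0'.
  have := hr u u' Au Bu.
  have u1 : enorm u' = 1 by case: Kpu'.
  have : enorm (s *: (u - u')) <= enorm (s *: u - s' *: u') + `|s - s'|.
    have -> : `|s - s'| = enorm ((s' - s) *: u') by rewrite enormZ u1 mulr1 distrC.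
    apply: le_trans (ler_enormD _ _); rewrite le_eqVlt; apply/orP; left; apply/eqP.
    by congr enorm; apply/matrixP => i j; rewrite !mxE; ring.
  rewrite enormZ ger0_norm//; have := enorm_ge0 (u - u'); nra.
by apply: le_hausdorff => x [|]; apply: parallel_setS; [exact: subsetUl|exact: subsetUr].
Qed.

End Parallel.

Section Eilenberg.
Context {R : realType} {n : nat}.
Context (K : set 'cV[R]_n.+1) (clK : closed K).
Local Open Scope ereal_scope.

Let bdryK p : bdry K p -> K p.
Proof. by move=> [+ _]; rewrite -(closure_id K).1. Qed.

(* Eilenberg's inequality for the level sets of the distance to [K]: a cover of
   the parallel set, cut along a suitable level [s] and projected to the
   boundary, covers the reverse spherical image. *)
Lemma surface_area_le_parallel (A : set (borelcV (R := R) (n := n.+1))) :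
  surface_area K A <=
  (2 * ball_volume n / ball_volume n.+1)%:E * parallel_measure K A.
Proof.
(* With b_k the volume of the unit ball of R^k, b_n (d/2)^n times the length d of an interval of
   levels equals C * b_(n+1) (d/2)^(n+1). *)
set C := (2 * ball_volume n / ball_volume n.+1)%R.
have b0 := @ball_volume_gt0 R n; have b1 := @ball_volume_gt0 R n.+1.
have C0 : (0 <= C)%R by rewrite divr_ge0 ?mulr_ge0// ltW.
apply: ge_ereal_sup => _ [delta d0 <-] /=.
apply: (@le_trans _ _ (C%:E * hausdorff_premeasure n.+1 delta (parallel_set K A))); last first.
  by rewrite lee_wpmul2l ?lee_fin//; exact: hausdorff_premeasure_le.
rewrite -[C%:E * _]muleC.
have C1 : (0 < C)%R by rewrite divr_gt0// mulr_gt0.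
rewrite -lee_pdivrMr//.
apply: le_ereal_inf_tmp => _ [F [Fd AF] <-].
rewrite lee_pdivrMr// muleC -nneseriesZl; last by move=> k _; exact: hausdorff_weight_ge0.
apply: lee_real; first exact: hausdorff_premeasure_ge0.
move=> M M0 hM.
(* The levels at which [F k] meets the parallel set; as [s] is 1-Lipschitz they fill an interval of
   length at most [d k]. *)
pose S k := [set s : R | exists p (u : 'cV[R]_n.+1), [/\ bdry K p, A u, outer_unit_normal K p u,
   (1 <= s <= 2)%R & F k (p + s *: u)%R]].
pose d k := fine (ediam (F k)).
have dE k x y : F k x -> F k y -> (enorm (x - y) <= d k)%R.
  move=> Fx Fy; have [e _] := fine_ediam _ _ (Fd k) (ex_intro _ x Fx).
  by apply: (ediam_leP (F k) (d k)).1 => //; rewrite e.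
have dd0 k : (0 <= d k)%R by exact: fine_ediam_ge0.
pose c k := if `[< S k !=set0 >] then (ball_volume n * (d k / 2) ^+ n)%R else 0%R.
(* When [S k] is empty this is a default value, harmless because then c k = 0. *)
pose a k := inf (S k).
have c0 k : (0 <= c k)%R.
  rewrite /c; case: asboolP => // _.
  by rewrite mulr_ge0 ?(ltW b0)// exprn_ge0// divr_ge0.
have Sdist k s s' : S k s -> S k s' -> (s <= s' + d k)%R.
  move=> [p [u [Kp Au Kpu s1 Fp]]] [p' [u' [Kp' Au' Kpu' s1' Fp']]].
  have s0 : (0 <= s)%R by lra.
  have s0' : (0 <= s')%R by lra.
  have [_ _ h] := parallel_dist K p p' u u' s s' (bdryK p Kp) (bdryK p' Kp') Kpu Kpu' s0 s0'.
  have := le_trans h (dE k _ _ Fp Fp'); rewrite ler_norml; lra.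
have Sitv k s : S k s -> (a k <= s <= a k + d k)%R.
  move=> Ss; apply/andP; split.
    by apply: ge_inf => //; exists 1%R => t [p [u [_ _ _ /andP[]]]].
  by rewrite -lerBlDr; apply: lb_le_inf; [exists s|move=> t St; rewrite lerBlDr; exact: Sdist].
have := averaging c a (fun k => a k + d k)%R 1 2 M _ M0 c0 _ _.
rewrite (_ : 2 - 1 = 1 :> R)%R ?mulr1; last by lra.
move=> /(_ _ _ _)/le_trans; apply.
- by lra.
- by move=> k; rewrite lerDl.
- move=> s hs; apply: le_trans hM _.
  (* The slice of [F k] at level [s], projected to the boundary; the projection does not increase
     the diameter. *)
  pose G k := [set p | exists (u : 'cV[R]_n.+1), [/\ bdry K p, A u, outer_unit_normal K p u &
     F k (p + s *: u)%R]].
  have s0 : (0 <= s)%R by lra.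
  have Gd k p p' : G k p -> G k p' -> (enorm (p - p') <= d k)%R.
    move=> [u [Kp Au Kpu Fp]] [u' [Kp' Au' Kpu' Fp']].
    have [h _ _] := parallel_dist K p p' u u' s s (bdryK p Kp) (bdryK p' Kp') Kpu Kpu' s0 s0.
    exact: le_trans h (dE k _ _ Fp Fp').
  apply: (@le_trans _ _ (\sum_(0 <= k <oo) hausdorff_weight n (G k))).
    apply: ereal_inf_lbound; exists G => //; split=> [k|p [Kp [u Au Kpu]]].
      have [->|/set0P[p Gp]] := eqVneq (G k) set0; first by apply/ediam_leP.
      have [u [_ _ _ Fp]] := Gp.
      have [e _] := fine_ediam _ _ (Fd k) (ex_intro _ _ Fp).
      apply: le_trans (Fd k); rewrite e; apply/ediam_leP; exact: Gd.
    have [k _ Fk] : (\bigcup_k F k) (p + s *: u)%R by apply: AF; exists p, u, s.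
    by exists k => //; exists u.
  apply: lee_nneseries => [k _ _|k _]; first exact: hausdorff_weight_ge0.
  have [->|/set0P[p Gp]] := eqVneq (G k) set0.
    by rewrite hausdorff_weight0 lee_fin mulr_ge0.
  have Ss : S k s by have [u [Kp Au Kpu Fp]] := Gp; exists p, u.
  rewrite (Sitv k s Ss) mulr1 /c asboolT; last by exists s.
  by apply: hausdorff_weight_le => //; exact: Gd.
apply: lee_nneseries => [k _ _|k _].
  by rewrite lee_fin mulr_ge0// addrAC subrr add0r.
rewrite addrAC subrr add0r /c; case: asboolP => [[s [p [u [_ _ _ _ Fp]]]]|_]; last first.
  by rewrite mul0r mule_ge0 ?lee_fin//; exact: hausdorff_weight_ge0.
rewrite hausdorff_weightE; last by exists (p + s *: u)%R.
rewrite -EFinM lee_fin -/(d k) exprSr le_eqVlt; apply/orP; left; apply/eqP.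
by rewrite /C; field; rewrite gt_eqF.
Qed.

End Eilenberg.

(** * Exit points and the surface area of half-spaces *)

Section ConvexBody.
Context {R : realType} {n m : nat}.
Context (K : set 'M[R]_(n, m)) (bK : convex_body K).
Implicit Types (x y u w : 'M[R]_(n, m)).

Lemma support_fun_sublinear : sublinear (support_fun K).
Proof.
have [_ cK _] := bK; have K0 := convex_body_nonempty K bK.
split=> [x y|a x a0].
  have [k Kk ->] := support_fun_max K (x + y) cK K0.
  by rewrite dotmxDl lerD// support_fun_ub.
apply/le_anti/andP; split.
  have [k Kk ->] := support_fun_max K (a *: x) cK K0.
  by rewrite dotmxZl ler_wpM2l// support_fun_ub.
have [k Kk ->] := support_fun_max K x cK K0.
by rewrite -dotmxZl support_fun_ub.
Qed.

Lemma continuous_support_fun : continuous (support_fun K).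
Proof. exact: cvx_fun_continuous (sublinear_cvx _ support_fun_sublinear). Qed.

Lemma interior_enorm : K° 0 -> exists2 r : R, 0 < r & forall y, enorm y <= r -> K y.
Proof.
move=> /nbhs_enormP[r r0 h]; exists (r / 2); first by rewrite divr_gt0.
by move=> y yr; apply: h; rewrite subr0 (le_lt_trans yr)// ltr_pdivrMr// ltr_pMr// ltr1n.
Qed.

Lemma support_fun_gt0 x : K° 0 -> x != 0 -> 0 < support_fun K x.
Proof.
move=> /interior_enorm[r r0 h] x0; have [_ cK _] := bK.
have x1 := enorm_gt0 x x0.
apply: (@lt_le_trans _ _ (dotmx x ((r / enorm x) *: x))).
  by rewrite dotmxZr mulr_gt0 ?divr_gt0// dotmx_gt0.
apply: support_fun_ub => //; apply: h.
by rewrite enormZ ger0_norm ?divr_ge0 ?(ltW r0) ?(ltW x1)// divfK// gt_eqF.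
Qed.

Lemma last_exit q w : K q -> w != 0 ->
  exists2 s : R, 0 <= s /\ K (q + s *: w) & forall t, s < t -> ~ K (q + t *: w).
Proof.
move=> Kq w0; have [_ cK _] := bK.
have [M M0 hM] := compact_mx_bounded K cK.
have w1 := enorm_gt0 w w0.
pose T := (M + enorm q) / enorm w.
have sT s : 0 <= s -> K (q + s *: w) -> s <= T.
  move=> s0 /hM h; rewrite ler_pdivlMr// -{1}(ger0_norm s0) -enormZ.
  have := ler_enormD (q + s *: w) (- q); rewrite addrAC subrr add0r enormN.
  by move=> /le_trans; apply; rewrite lerD2r.
pose line (s : R) := q + s *: w.
have cl : continuous line.
  move=> s; apply: cvgD; first exact: cvg_cst.
  by apply: cvgZr_tmp; exact: cvg_id.
pose S := `[0, T]%classic `&` line @^-1` K.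
have cS : compact S.
  apply: (subclosed_compact _ (segment_compact (a := 0) (b := T))); last by move=> s [].
  apply: closedI; first exact: itv_closed.
  by apply: closed_comp => [s _|]; [exact: cl|exact: convex_body_closed].
have S0 : S !=set0.
  exists 0; split; last by rewrite /line /= scale0r addr0.
  by rewrite /= in_itv/= lexx divr_ge0 ?(ltW w1)// addr_ge0 ?(ltW M0)// enorm_ge0.
have cid : {within S, continuous (id : R -> R)}.
  by apply: continuous_subspaceT => s; exact: cvg_id.
have [s /set_mem[]] := compact_EVT_max S0 cS cid.
rewrite /= in_itv/= => /andP[s0 _] Ks smax; exists s => // t st Kt.
have t0 : 0 <= t by rewrite (le_trans s0)// ltW.
have := smax t; rewrite leNgt st => /(_ _)/negP; apply => //.
by apply/mem_set; split=> //; rewrite /= in_itv/= t0 sT.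
Qed.

(** The normal minimises the slack [phi] of the support inequalities at the exit point over unit
    vectors: a positive minimum would let the ray go further inside [K]. Since [K] contains the ball
    of radius r, r <= u.q + s * u.w with u.q <= r / 2, so u.w > 0. *)
Lemma exit_normal (r : R) q w : 0 < r -> (forall y, enorm y <= r -> K y) ->
  enorm q <= r / 2 -> w != 0 ->
  exists s u, [/\ bdry K (q + s *: w), enorm u = 1,
    forall z, K z -> dotmx u z <= dotmx u (q + s *: w) & 0 < dotmx u w].
Proof.
move=> r0 rK qr w0; have [_ cK _] := bK.
have Kq : K q by apply: rK; rewrite (le_trans qr)// ler_pdivrMr// ler_pMr// ler1n.
have [s [s0 Ks] smax] := last_exit q w Kq w0.
set p := q + s *: w in Ks *.
have w1 := enorm_gt0 w w0.
pose phi u := support_fun K u - dotmx u p.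
have E0 : [set u : 'M[R]_(n, m) | enorm u = 1] !=set0.
  exists ((enorm w)^-1 *: w); rewrite /= enormZ ger0_norm ?invr_ge0 ?(ltW w1)//.
  by rewrite mulVf// gt_eqF.
have cphi : continuous phi.
  move=> u; have c1 := continuous_support_fun u.
  have c2 : dotmx^~ p @ u --> dotmx u p.
    rewrite (_ : dotmx^~ p = dotmx p); first by rewrite dotmxC; exact: continuous_dotmxr.
    by apply/funext => x; rewrite dotmxC.
  exact: cvgB c1 c2.
have [u /set_mem/= u1 umin] := compact_EVT_min E0 compact_sphere (continuous_subspaceT cphi).
have phi0 : phi u <= 0.
  (* A further step [e] raises x.p by at most e |w| |x| = phi u |x|, which the slack at x absorbs by
     homogeneity. *)
  rewrite leNgt; apply/negP => v0; pose e := phi u / enorm w.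
  have e0 : 0 < e by rewrite divr_gt0.
  apply: (smax (s + e)); first by rewrite ltrDl.
  apply: support_fun_mem => // x; rewrite scalerDl addrA -/p.
  have [->|x0] := eqVneq x 0.
    by rewrite dotmx0l; case: support_fun_sublinear => _ /(_ 0 0 (lexx _));
      rewrite scale0r mul0r => ->.
  have x1 := enorm_gt0 x x0.
  have ux : enorm ((enorm x)^-1 *: x) = 1.
    by rewrite enormZ ger0_norm ?invr_ge0 ?(ltW x1)// mulVf// gt_eqF.
  have := umin _ (mem_set (ux : [set u | enorm u = 1] _)).
  rewrite {2}/phi support_fun_sublinear.2 ?invr_ge0 ?(ltW x1)// dotmxZl -mulrBr.
  rewrite ler_pdivlMl// => h.
  rewrite dotmxDr dotmxZr -lerBrDl; apply: le_trans h.
  have <- : e * enorm w = phi u by rewrite /e divfK// gt_eqF.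
  by rewrite mulrCA ler_pM2l// cauchy_schwarz.
have hu : support_fun K u = dotmx u p.
  apply/le_anti; rewrite -subr_le0 phi0/=; exact: support_fun_ub.
have nu z : K z -> dotmx u z <= dotmx u p by move=> Kz; rewrite -hu support_fun_ub.
exists s, u; split=> //.
  split; first exact: subset_closure.
  move=> /nbhs_enormP[d d0 hd].
  have := nu (p + (d / 2) *: u); rewrite dotmxDr dotmxZr -enorm_sq u1 expr1n mulr1.
  have /hd Kd : enorm (p + (d / 2) *: u - p) < d.
    rewrite addrAC subrr add0r enormZ u1 mulr1 ger0_norm ?divr_ge0 ?(ltW d0)//.
    by rewrite ltr_pdivrMr// ltr_pMr// ltr1n.
  by move=> /(_ Kd); lra.
have /nu : K (r *: u) by apply: rK; rewrite enormZ u1 mulr1 ger0_norm// ltW.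
rewrite dotmxZr -enorm_sq u1 expr1n mulr1 /p dotmxDr dotmxZr.
have := cauchy_schwarz u q; rewrite u1 mul1r => h1 h2.
have h3 : 0 < s * dotmx u w by lra.
move: s0; rewrite le_eqVlt => /predU1P[s0|s0]; first by rewrite -s0 mul0r ltxx in h3.
by rewrite pmulr_rgt0 in h3.
Qed.

End ConvexBody.

Section SurfaceArea.
Context {R : realType} {n : nat}.
Context (K : set 'cV[R]_n.+1) (bK : convex_body_o K).
Implicit Types (A B : set (borelcV (R := R) (n := n.+1))) (u w : 'cV[R]_n.+1).
Local Open Scope ereal_scope.

Lemma surface_area0 : surface_area K set0 = 0.
Proof.
rewrite /surface_area (_ : [set _ | _] = set0) ?hausdorff0//.
by rewrite -subset0 => y [_ [u]].
Qed.

Lemma surface_area_ge0 A : 0 <= surface_area K A.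
Proof. exact: hausdorff_ge0. Qed.

Lemma le_surface_area A B : A `<=` B -> surface_area K A <= surface_area K B.
Proof.
by move=> AB; apply: le_hausdorff => y [Ky [u Au Kyu]]; split=> //; exists u => //; exact: AB.
Qed.

Lemma surface_area_sigma_subadditive (F : nat -> set (borelcV (R := R) (n := n.+1))) :
  surface_area K (\bigcup_k F k) <= \sum_(0 <= k <oo) surface_area K (F k).
Proof.
apply: le_trans (hausdorff_sigma_subadditive _ _).
by apply: le_hausdorff => y [Ky [u [k _ Fu] Kyu]]; exists k => //; split=> //; exists u.
Qed.

Lemma surface_areaU A B :
  surface_area K (A `|` B) <= surface_area K A + surface_area K B.
Proof.
apply: le_trans (outer_measureU2 (@hausdorff R n.+1 n) _ _).
by apply: le_hausdorff => y [Ky [u [Au|Bu] Kyu]]; [left|right]; split=> //; exists u.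
Qed.

Lemma surface_area_bounded_subadditive :
  exists C : R, bounded_subadditive (surface_area K) C.
Proof.
have [[_ cK _] K0] := bK; have clK := convex_body_closed K bK.1.
have [M M0 hM] := compact_mx_bounded K cK.
set C := (2 * @ball_volume R n / @ball_volume R n.+1)%R.
have C0 : (0 <= C)%R by rewrite divr_ge0 ?mulr_ge0// ltW// ball_volume_gt0.
have fin : parallel_measure K setT < +oo.
  (* Points of the parallel set have norm at most M + 2, and [hausdorff_bounded] asks for a strict
     bound. *)
  have M3 : (0 < M + 3)%R by lra.
  apply: (hausdorff_bounded _ _ M3) => _ [p [u [s [[+ _] _ [u1 _] s12 ->]]]] i.
  rewrite -(closure_id K).1// => Kp.
  have {}u1 : enorm (u : 'cV[R]_n.+1) = 1%R := u1.
  apply: le_lt_trans (ler_coord_enorm _ _ _) _; apply: le_lt_trans (ler_enormD _ _) _.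
  rewrite enormZ u1 mulr1 ger0_norm; last by lra.
  by have := hM p Kp; lra.
exists (C * fine (parallel_measure K setT))%R; split.
- exact: surface_area0.
- exact: surface_area_ge0.
- exact: le_surface_area.
- exact: surface_areaU.
move=> I P mP tP.
have pfin : parallel_measure K setT \is a fin_num.
  by rewrite ge0_fin_numE// parallel_measure_ge0.
rewrite EFinM fineK//.
apply: (@le_trans _ _ (\sum_i C%:E * parallel_measure K (P i))).
  by apply: lee_sum => i _; exact: surface_area_le_parallel.
rewrite -ge0_sume_distrr; last by move=> i _; exact: parallel_measure_ge0.
rewrite lee_wpmul2l ?lee_fin//.
exact: (borel_sum_le (parallel_measure K) (parallel_measure_metric K clK) I P mP tP).
Qed.

(* The shadow of the part of the boundary lit from direction [w]: the projection
   along [w] to a coordinate hyperplane is 2-Lipschitz in the sup norm and maps it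
   onto a neighbourhood of the origin. *)
Lemma surface_area_halfspace_gt0 w : w != 0%R ->
  0 < surface_area K [set u : 'cV[R]_n.+1 | enorm u = 1%R /\ (0 < dotmx u w)%R].
Proof.
move=> w0; have [[_ cK _] K0] := bK.
have [r r0 rK] := interior_enorm K K0.
pose A := [set u : 'cV[R]_n.+1 | enorm u = 1%R /\ (0 < dotmx u w)%R].
have b0 := @ball_volume_gt0 R n.
(* At the largest coordinate of [w] the ratios w i / w i0 are at most 1 in absolute value; this
   gives the Lipschitz constant 2 of [Pr]. *)
have [i0 wi0] : exists i0, (`|w| = `|w i0 0%R|)%R.
  have := @mx_norm_neq0 _ _ _ w; rewrite -[mx_norm w]/(`|w|%R) normr_eq0 => /(_ w0)[[i j] /=].
  by rewrite (ord1 j) => ->; exists i.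
have w1 : (0 < `|w i0 0%R|)%R by rewrite -wi0 normr_gt0.
(* Projection along [w] onto the hyperplane where coordinate [i0] vanishes, read in the other n
   coordinates; [q] embeds these back. *)
pose Pr (x : 'cV[R]_n.+1) (i : 'I_n) : R :=
  (x (lift i0 i) 0 - w (lift i0 i) 0 / w i0 0 * x i0 0)%R.
have PrL x y i : (`|Pr x i - Pr y i| <= 2 * enorm (x - y))%R.
  have -> : (Pr x i - Pr y i = (x - y) (lift i0 i) 0 - w (lift i0 i) 0 / w i0 0 * (x - y) i0 0)%R.
    by rewrite /Pr !mxE; ring.
  apply: le_trans (ler_normB _ _) _.
  rewrite (_ : 2 * _ = enorm (x - y) + enorm (x - y))%R; last by ring.
  apply: lerD; first exact: ler_coord_enorm.
  rewrite normrM -[leRHS]mul1r; apply: ler_pM => //; last exact: ler_coord_enorm.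
  by rewrite normf_div ler_pdivrMr// mul1r -wi0 ler_coord_norm.
pose q (x : nat -> R) : 'cV[R]_n.+1 := (\col_i if unlift i0 i is Some j then x j else 0)%R.
(* The cube of half-side [rho] must land in the ball of radius r / 2, the range of starting points
   of [exit_normal]. *)
pose rho := (r / 2 / ((1 * n.+1).+1%:R))%R.
have rho0 : (0 < rho)%R by rewrite !divr_gt0.
have qr x : (forall i, (i < n)%N -> (- rho <= x i <= - rho + 2 * rho)%R) ->
    (enorm (q x) <= r / 2)%R.
  move=> hx; rewrite (_ : r / 2 = (1 * n.+1).+1%:R * rho)%R; last first.
    by rewrite /rho mulrCA divff ?mulr1// pnatr_eq0.
  apply: ler_enorm_coord; first exact: ltW.
  move=> i j; rewrite mxE; case: unliftP => [k _|_]; last by rewrite normr0 ltW.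
  by have := hx k (ltn_ord k); rewrite ler_norml; lra.
(* A box of half-width 2 * d k has side 4 * d k = 8 * (d k / 2), hence 8 ^ n against the (d k / 2) ^
   n in the weight. *)
have key : ((2 * rho) ^+ n * (ball_volume n / 8 ^+ n))%:E <= surface_area K A.
  apply: le_trans (hausdorff_premeasure_le n 1 _ ltr01).
  apply: le_ereal_inf_tmp => _ [F [Fd AF] <-].
  pose d k := fine (ediam (F k)).
  have d0 k : (0 <= d k)%R by exact: fine_ediam_ge0.
  have dE k x y : F k x -> F k y -> (enorm (x - y) <= d k)%R.
    move=> Fx Fy; have [e _] := fine_ediam _ _ (Fd k) (ex_intro _ x Fx).
    by apply: (ediam_leP (F k) (d k)).1 => //; rewrite e.
  (* Only a nonempty [F k] has a point [z k] to centre the box at; the others are switched off. *)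
  pose e k := `[< F k !=set0 >].
  pose z k := get (F k).
  pose crd k (i : nat) : R := if insub i is Some j then Pr (z k) j else 0%R.
  have := box_cover n e (fun k i => crd k i - 2 * d k)%R (fun k i => crd k i + 2 * d k)%R
    (- rho) (2 * rho).
  have c0 : (0 <= ball_volume n / 8 ^+ n :> R)%R by rewrite divr_ge0 ?(ltW b0)// exprn_ge0.
  move=> bc; rewrite EFinM; apply: le_trans (lee_wpmul2r _ (bc _ _ _)) _ => //.
  - by rewrite mulr_ge0// ltW.
  - by move=> k i; have := d0 k; lra.
  - move=> x hx.
    have [s [u [Kp u1 hu uw]]] := exit_normal K bK.1 r (q x) w r0 rK (qr x hx) w0.
    have [k _ Fk] : (\bigcup_k F k) (q x + s *: w)%R by apply: AF; split=> //; exists u.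
    exists k; split; first by apply/asboolP; exists (q x + s *: w)%R.
    move=> i ilt; have Fz : F k (z k) by apply: getPex; exists (q x + s *: w)%R.
    have := PrL (q x + s *: w)%R (z k) (Ordinal ilt).
    have -> : Pr (q x + s *: w)%R (Ordinal ilt) = x i.
      rewrite /Pr !mxE liftK unlift_none; field.
      by rewrite -normr_gt0.
    rewrite /crd insubT /=; have := dE k _ _ Fk Fz; rewrite ler_norml => h1 h2.
    have -> : Sub i ilt = Ordinal ilt by [].
    by move: h2; lra.
  rewrite muleC -nneseriesZl; last first.
    by move=> k _; rewrite lee_fin mulr_ge0// prodr_ge0// => i _; have := d0 k; lra.
  apply: lee_nneseries => [k _ _|k _].
    rewrite mule_ge0 ?lee_fin ?divr_ge0 ?(ltW b0) ?exprn_ge0//.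
    by rewrite mulr_ge0// prodr_ge0// => i _; have := d0 k; lra.
  rewrite /e; case: asboolP => [Fk|_]; last by rewrite mul0r mule0 hausdorff_weight_ge0.
  rewrite hausdorff_weightE// -EFinM lee_fin mul1r.
  rewrite (eq_bigr (fun=> 4 * d k)%R); last by move=> i _; ring.
  rewrite prodr_const card_ord -/(d k) le_eqVlt; apply/orP; left; apply/eqP.
  rewrite (_ : 4 * d k = 8 * (d k / 2))%R; last by field.
  by rewrite exprMn mulrA divfK// expf_neq0.
apply: lt_le_trans key; rewrite lte_fin mulr_gt0 ?exprn_gt0 ?mulr_gt0//.
Qed.

End SurfaceArea.

(** * The integrand *)

Lemma cvg_mx {R : realType} {n m : nat} {T : Type} (F : set_system T)
    {FF : Filter F} (f : T -> 'M[R]_(n, m)) (l : 'M[R]_(n, m)) :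
  (forall i j, f t i j @[t --> F] --> l i j) -> f @ F --> l.
Proof.
move=> h; apply/cvgrPdist_le => e e0.
have hk : \forall t \near F, forall k : 'I_n * 'I_m, `|l k.1 k.2 - f t k.1 k.2| <= e.
  apply: filter_forall => k; have /cvgrPdist_le := h k.1 k.2; exact.
apply: filterS hk => t ht; apply: ler_mx_norm (ltW e0) _ => i j.
by rewrite !mxE; exact: (ht (i, j)).
Qed.

(** Openness is asked away from the origin only, since the integrand divides by the support
    function, which vanishes there. *)
Lemma borel_sphere {R : realType} {n : nat} (O : set 'cV[R]_n) :
  (forall u, u != 0 -> O u -> nbhs u O) ->
  measurable ((usphere : set (borelcV (R := R) (n := n))) `&` O).
Proof.
move=> hO.
have mS : measurable (usphere : set (borelcV (R := R) (n := n))).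
  rewrite -[usphere]setCK; apply: measurableC; apply: sub_sigma_algebra.
  have cS : closed ((@enorm R n 1) @^-1` [set 1]).
    by apply: closed_comp => [x _|]; [exact: continuous_enorm|exact: closed_eq].
  exact: closed_openC cS.
have -> : (usphere : set (borelcV (R := R) (n := n))) `&` O =
    usphere `&` (O `&` [set u : 'cV[R]_n | u != 0]).
  apply/seteqP; split=> u [Su]; last by case.
  move=> Ou; split=> //; split=> //=; apply: contra_eq_neq Su => ->.
  by rewrite enorm0 eq_sym oner_neq0.
apply: measurableI => //; apply: sub_sigma_algebra.
have o0 : open [set u : 'cV[R]_n | u != 0].
  have -> : [set u : 'cV[R]_n | u != 0] = ~` [set 0].
    by apply/seteqP; split=> u /= /eqP.
  by apply: closed_openC; apply: accessible_closed_set1; apply: hausdorff_accessible;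
    exact: mx_hausdorff.
rewrite /= openE => u [Ou u0]; apply: filterI; first exact: hO.
exact: open_nbhs_nbhs.
Qed.

Lemma measurable_fun_sphere {R : realType} {n : nat} (f : 'cV[R]_n -> R) :
  (forall u : 'cV[R]_n, u != 0 -> f x @[x --> u] --> f u) ->
  measurable_fun (usphere : set (borelcV (R := R) (n := n))) f.
Proof.
move=> cf; apply: (measurability _ (RGenOInfty.measurableE R)).
move=> _ [_ [x ->] <-]; apply: borel_sphere => u u0 /=.
rewrite in_itv/= andbT => xf; apply: filterS (cvgr_gt _ (cf u u0) _ xf) => y /=.
by rewrite in_itv/= andbT.
Qed.

Section OrliczIntegrand.
Context {R : realType} {n m : nat}.
Context (Phi : 'rV[R]_m -> R) (PhiC : orlicz_class Phi).
Context (K : set 'cV[R]_n.+1) (bK : convex_body_o K).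
Implicit Types (x y : 'M[R]_(n.+1, m)) (u : 'cV[R]_n.+1) (t : R).

Let S : set (borelcV (R := R) (n := n.+1)) := usphere.
Let h := support_fun K.
Let Phi_cvx : cvx_fun Phi := convex_functionP _ (orlicz_convex PhiC).

Definition integrand x u := Phi ((h u)^-1 *: (u^T *m x)) * h u.

Lemma orlicz_ray z t t' : 0 <= t -> t <= t' -> Phi (t *: z) <= Phi (t' *: z).
Proof.
move=> t0 tt'; have [t'0|t'0] := leP t' 0.
  have -> : t = t' by apply/le_anti; rewrite tt' (le_trans t'0 t0).
  exact: lexx.
have := cvx_fun_ray _ (t' *: z) (t / t') Phi_cvx (orlicz_0 PhiC).
rewrite scalerA divfK ?gt_eqF// divr_ge0 ?(ltW t'0)// ler_pdivrMr// mul1r => /(_ isT tt').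
move/le_trans; apply; rewrite ler_piMl ?(orlicz_ge0 PhiC)//.
by rewrite ler_pdivrMr// mul1r.
Qed.

Let sphere_neq0 u : S u -> u != 0.
Proof. by move=> Su; apply: contra_eq_neq Su => ->; rewrite enorm0 eq_sym oner_neq0. Qed.

Let h_gt0 u : u != 0 -> 0 < h u.
Proof. by move=> u0; apply: support_fun_gt0 => //; case: bK. Qed.

Lemma integrand_ge0 x u : S u -> 0 <= integrand x u.
Proof.
by move=> /sphere_neq0/h_gt0 hu; rewrite mulr_ge0 ?(orlicz_ge0 PhiC)// ltW.
Qed.

Lemma integrand_cvg x u : u != 0 -> integrand x v @[v --> u] --> integrand x u.
Proof.
move=> u0; have ch : h v @[v --> u] --> h u by exact: continuous_support_fun bK.1 u.
suff hz : (fun v : 'cV[R]_n.+1 => (h v)^-1 *: (v^T *m x)) @ u --> (h u)^-1 *: (u^T *m x).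
  have hP := cvg_comp _ Phi hz (cvx_fun_continuous Phi Phi_cvx _).
  exact: (cvgM hP ch).
apply: (@cvg_mx R _ _ _ (nbhs u) _) => i j.
have E v : ((h v)^-1 *: (v^T *m x)) i j = (h v)^-1 * dotmx (col j x) v.
  rewrite !mxE dotmxE big_ord1; congr (_ * _); apply: eq_bigr => k _.
  by rewrite !mxE (ord1 i) mulrC.
rewrite E; under eq_cvg do rewrite E.
have cV : (h v)^-1 @[v --> u] --> (h u)^-1 by exact: (cvgV (lt0r_neq0 (h_gt0 u u0)) ch).
have cd : dotmx (col j x) v @[v --> u] --> dotmx (col j x) u by exact: continuous_dotmxr.
exact: (cvgM cV cd).
Qed.

Lemma measurable_integrand x : measurable_fun S (integrand x).
Proof. by apply: measurable_fun_sphere => u; exact: integrand_cvg. Qed.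

Lemma integrand_bounded x : exists2 B, 0 <= B & forall u, S u -> integrand x u <= B.
Proof.
have S0 : [set u : 'cV[R]_n.+1 | enorm u = 1] !=set0.
  have d0 : delta_mx ord0 0 != 0 :> 'cV[R]_n.+1.
    apply/eqP => /matrixP /(_ ord0 0)/eqP; rewrite !mxE !eqxx /=.
    by rewrite oner_eq0.
  exists ((enorm (delta_mx ord0 0 : 'cV[R]_n.+1))^-1 *: delta_mx ord0 0) => /=.
  by rewrite enormZ ger0_norm ?invr_ge0 ?enorm_ge0// mulVf// gt_eqF// enorm_gt0.
have cf : {within [set u : 'cV[R]_n.+1 | enorm u = 1], continuous (integrand x)}.
  by apply: continuous_in_subspaceT => u /set_mem Su; apply: integrand_cvg; exact: sphere_neq0.
have [u /set_mem Su hu] := compact_EVT_max S0 compact_sphere cf.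
exists (integrand x u); first exact: integrand_ge0.
by move=> v Sv; apply: hu; apply/mem_set.
Qed.

Lemma integrand_cvx x y t u : 0 <= t -> t <= 1 -> S u ->
  integrand (t *: x + (1 - t) *: y) u <= t * integrand x u + (1 - t) * integrand y u.
Proof.
move=> t0 t1 /sphere_neq0/h_gt0 hu; rewrite /integrand !mulrA -mulrDl ler_pM2r//.
have -> : (h u)^-1 *: (u^T *m (t *: x + (1 - t) *: y)) =
    t *: ((h u)^-1 *: (u^T *m x)) + (1 - t) *: ((h u)^-1 *: (u^T *m y)).
  by rewrite mulmxDr -!scalemxAr scalerDr !scalerA ![(h u)^-1 * _]mulrC.
exact: Phi_cvx.
Qed.

(** Convexity between t x and 0. This is the linear growth along rays. *)
Lemma integrand_scale x t u : 1 <= t -> S u -> t * integrand x u <= integrand (t *: x) u.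
Proof.
move=> t1 Su; have t0 : 0 < t by lra.
have := integrand_cvx (t *: x) 0 t^-1 u _ _ Su.
rewrite invr_ge0 (ltW t0) invf_le1// => /(_ isT t1).
rewrite scaler0 addr0 scalerA mulVf ?gt_eqF// scale1r.
rewrite {3}/integrand mulmx0 scaler0 (orlicz_0 PhiC) mul0r mulr0 addr0.
by rewrite mulrC ler_pdivlMr// mulrC.
Qed.

(* The directions along which [Phi] vanishes form a closed convex cone which is
   not the whole space, since [Phi z + Phi (- z) > 0]. *)
Lemma orlicz_direction x : x != 0 -> exists2 w : 'cV[R]_n.+1, w != 0 &
  forall u, 0 < dotmx u w -> exists2 t, 0 <= t & 0 < Phi (t *: (u^T *m x)).
Proof.
move=> x0; pose D := [set u : 'cV[R]_n.+1 | forall t, 0 <= t -> Phi (t *: (u^T *m x)) = 0].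
have D0 : D 0 by move=> t _; rewrite trmx0 mul0mx scaler0 (orlicz_0 PhiC).
have vD : cvx_closed D.
  move=> u v l l0 l1 Du Dv t t0; apply/le_anti; rewrite (orlicz_ge0 PhiC) andbT.
  have -> : t *: ((l *: u + (1 - l) *: v)^T *m x) =
      l *: (t *: (u^T *m x)) + (1 - l) *: (t *: (v^T *m x)).
    rewrite linearD/= !linearZ/= mulmxDl -!scalemxAl scalerDr !scalerA.
    by rewrite ![t * _]mulrC.
  by apply: le_trans (Phi_cvx _ _ _ l0 l1) _; rewrite Du// Dv// !mulr0 addr0.
have clD : closed D.
  have -> : D = \bigcap_(t in [set t | 0 <= t])
      (fun u : 'cV[R]_n.+1 => Phi (t *: (u^T *m x))) @^-1` [set 0].
    by apply/seteqP; split=> u Du t t0; exact: Du.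
  apply: closed_bigI => t _; apply: closed_comp; last exact: closed_eq.
  move=> u _; suff hz : (fun v : 'cV[R]_n.+1 => t *: (v^T *m x)) @ u --> t *: (u^T *m x).
    exact: (cvg_comp _ Phi hz (cvx_fun_continuous Phi Phi_cvx _)).
  apply: (@cvg_mx R _ _ _ (nbhs u) _) => i j.
  have E (v : 'cV[R]_n.+1) : (t *: (v^T *m x)) i j = dotmx (t *: col j x) v.
    rewrite dotmxZl !mxE dotmxE big_ord1; congr (_ * _); apply: eq_bigr => k _.
    by rewrite !mxE (ord1 i) mulrC.
  rewrite E; under eq_cvg do rewrite E.
  exact: continuous_dotmxr.
have [v Dv] : exists v, ~ D v.
  have [i [j xij]] : exists i j, x i j != 0.
    apply: contrapT => hx; case/eqP: x0; apply/matrixP => i j; rewrite mxE.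
    by apply/eqP; apply: contrapT => /negP xij; apply: hx; exists i, j.
  pose v : 'cV[R]_n.+1 := delta_mx i 0.
  have z0 : v^T *m x != 0.
    apply: contra xij => /eqP/matrixP/(_ 0 j); rewrite trmx_delta -rowE !mxE => ->.
    exact: eqxx.
  have := orlicz_gt0 PhiC z0 => hz.
  have [Dv|] := pselect (D v); last by exists v.
  exists (- v) => DNv; have := Dv 1 ler01; have := DNv 1 ler01.
  by rewrite linearN/= mulNmx !scale1r => e1 e2; move: hz; rewrite e1 e2 addr0 ltxx.
have [w w0 [c cw hw]] := separation D v vD clD (ex_intro _ 0 D0) Dv.
exists w => // u uw; apply: contrapT => hu.
have Du : D u.
  move=> t t0; apply/le_anti; rewrite (orlicz_ge0 PhiC) andbT leNgt.
  by apply/negP => h1; apply: hu; exists t.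
have c0 : 0 <= c by have := hw 0 D0; rewrite dotmx0r.
have DZ t : 0 <= t -> D (t *: u).
  by move=> t0 s s0; rewrite linearZ/= -scalemxAl scalerA Du// mulr_ge0.
rewrite dotmxC in uw.
(* The multiple of [u] on which [w] takes the value c + 1 would lie in [D], beyond the bound c. *)
have := hw _ (DZ ((c + 1) / dotmx w u) _); rewrite dotmxZr divfK ?gt_eqF//.
by move=> /(_ (ltac:(by rewrite divr_ge0 ?(ltW uw)// addr_ge0))); lra.
Qed.

End OrliczIntegrand.

(** * The integral as a convex function of x, and its gauge *)

Section ConeVolume.
Context {R : realType} {n m : nat}.
Context (Phi : 'rV[R]_m -> R) (PhiC : orlicz_class Phi).
Context (K : set 'cV[R]_n.+1) (bK : convex_body_o K).
Implicit Types (x y : 'M[R]_(n.+1, m)).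

Let S : set (borelcV (R := R) (n := n.+1)) := usphere.

Lemma cone_volume_gt0 (V := (n.+1%:R%:E * volume K)%E) :
  V = (fine V)%:E /\ 0 < fine V.
Proof.
have [[_ cK _] K0] := bK.
have [r r0 rK] := interior_enorm K K0.
have [M M0 hM] := compact_mx_bounded K cK.
pose rho := r / (1 * n.+1).+1%:R.
have rho0 : 0 < rho by rewrite divr_gt0.
have vK : (((2 * rho) ^+ n.+1)%:E <= volume K)%E.
  apply: volume_ge (ltW rho0) _ => x hx; apply: rK.
  rewrite (_ : r = (1 * n.+1).+1%:R * rho); last by rewrite mulrC divfK.
  by apply: ler_enorm_coord (ltW rho0) _ => i j; rewrite (ord1 j).
have Kv : (volume K < +oo)%E.
  apply: (volume_lty _ _ (ltn0Sn n) (ltW M0)) => x Kx i.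
  exact: le_trans (ler_coord_enorm _ _ _) (hM x Kx).
have v0 : (0 < volume K)%E.
  by apply: lt_le_trans vK; rewrite lte_fin exprn_gt0// mulr_gt0.
have vf : volume K \is a fin_num by rewrite ge0_fin_numE// ltW.
have e : V = (n.+1%:R * fine (volume K))%:E by rewrite /V EFinM fineK.
rewrite e /=; split=> //; rewrite mulr_gt0// -lte_fin fineK//.
Qed.

Lemma cone_integral_gauge (V : R) : 0 < V ->
  exists G : 'M[R]_(n.+1, m) -> R, [/\ cvx_fun G, G 0 = 0,
    forall x, x != 0 -> exists2 t, 0 < t & V < G (t *: x) &
    forall x, (\int[surface_area K]_(u in S) (integrand Phi K x u)%:E)%E = (G x)%:E].
Proof.
move=> V0; have [C bmu] := surface_area_bounded_subadditive K bK.
have [[_ cK _] K0] := bK.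
have mS : measurable S by rewrite -[S]setIT; apply: borel_sphere => u _ _; exact: filterT.
pose f x := integrand Phi K x : borelcV (R := R) (n := n.+1) -> R.
have f0 x u : S u -> 0 <= f x u by exact: integrand_ge0 PhiC K bK x u.
pose G x := fine (\int[surface_area K]_(u in S) (f x u)%:E)%E.
have GE x : (\int[surface_area K]_(u in S) (f x u)%:E)%E = (G x)%:E.
  have [B B0 hB] := integrand_bounded Phi PhiC K bK x.
  exact: (subadd_integral_fin _ _ bmu _ _ B (f0 x) B0 hB).
exists G; split=> //.
- move=> x y t t0 t1.
  have [Bx Bx0 hBx] := integrand_bounded Phi PhiC K bK x.
  have [By By0 hBy] := integrand_bounded Phi PhiC K bK y.
  apply: (subadd_integral_convex _ _ bmu _ mS (f x) (f y) (f (t *: x + (1 - t) *: y)) (Bx + By) t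
    (measurable_integrand Phi PhiC K bK x) (measurable_integrand Phi PhiC K bK y)) => //.
  + exact: addr_ge0.
  + by move=> u Su; rewrite f0//= (le_trans (hBx u Su))// lerDl.
  + by move=> u Su; rewrite f0//= (le_trans (hBy u Su))// lerDr.
  + by move=> u Su; rewrite f0//=; exact: integrand_cvx.
- apply/le_anti/andP; split; last first.
    by rewrite -lee_fin -GE; exact: (subadd_integral_ge0 _ _ bmu _ _ (f0 0)).
  rewrite -lee_fin -GE; have := subadd_integral_le _ _ bmu _ (f 0) 0 (f0 0) (lexx _).
  rewrite mul0r; apply => u Su.
  by rewrite /f /integrand mulmx0 scaler0 (orlicz_0 PhiC) mul0r.
move=> x x0; have [w w0 hw] := orlicz_direction Phi PhiC x x0.
(* These Borel sets exhaust the half-space on which the integrand eventually becomes positive, so by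
   countable subadditivity one of them has positive mass. *)
pose E j : set (borelcV (R := R) (n := n.+1)) :=
  S `&` [set u | j.+1%:R^-1 < f (j.+1%:R *: x) u].
have mE j : measurable (E j).
  apply: borel_sphere => u u0 /= hu.
  exact: (cvgr_gt _ (integrand_cvg Phi PhiC K bK (j.+1%:R *: x) u u0) _ hu).
have cov : [set u : 'cV[R]_n.+1 | enorm u = 1 /\ 0 < dotmx u w] `<=` \bigcup_j E j.
  move=> u [u1 uw]; have [t t0 ht] := hw u uw.
  have u0 : u != 0 by apply: contra_eq_neq u1 => ->; rewrite enorm0 eq_sym oner_neq0.
  have hu : 0 < support_fun K u by apply: support_fun_gt0 => //; case: bK.
  pose c := Phi (t *: (u^T *m x)) * support_fun K u.
  have c0 : 0 < c by rewrite mulr_gt0.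
  (* j + 1 must exceed t * h_K(u), so that the ray has passed [t], and also 1 / c. *)
  pose j := Num.truncn (t * support_fun K u + c^-1).
  have hj : t * support_fun K u + c^-1 < j.+1%:R := truncnS_gt _.
  have th0 : 0 <= t * support_fun K u by rewrite mulr_ge0// ltW.
  have ci0 : 0 < c^-1 by rewrite invr_gt0.
  exists j => //; split=> //=; apply: (@lt_le_trans _ _ c).
    by rewrite invf_plt ?posrE ?ltr0n//; lra.
  rewrite /f /integrand -scalemxAr scalerA ler_pM2r//.
  apply: orlicz_ray => //; rewrite mulrC ler_pdivlMr//; lra.
have [j Ej] : exists j, (0 < surface_area K (E j))%E.
  apply: contrapT => hE.
  have := surface_area_halfspace_gt0 K bK w w0.
  rewrite ltNge => /negP; apply.
  apply: le_trans (le_surface_area K _ _ cov) _.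
  apply: le_trans (surface_area_sigma_subadditive K E) _.
  rewrite eseries0// => j _ _; apply/le_anti; rewrite surface_area_ge0 andbT leNgt.
  by apply/negP => h; apply: hE; exists j.
have Efin := bsub_fin _ _ bmu (E j) (mE j).
set mu1 := fine (surface_area K (E j)) in Efin.
have mu10 : 0 < mu1 by rewrite -lte_fin -Efin.
(* The second summand alone contributes V + 1 to the lower bound T / (j + 1) * mu1; the summand 1
   gives T >= 1, as [integrand_scale] requires. *)
pose T := 1 + (V + 1) * j.+1%:R / mu1.
have T1 : 1 <= T by rewrite lerDl divr_ge0 ?(ltW mu10)// mulr_ge0//; lra.
exists (T * j.+1%:R); first by rewrite mulr_gt0//; lra.
have lower : T / j.+1%:R * mu1 <= G ((T * j.+1%:R) *: x).
  rewrite -lee_fin -GE.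
  have := le_subadd_integral _ _ bmu _ (f ((T * j.+1%:R) *: x)) unit (fun=> E j)
    (fun=> T / j.+1%:R) (f0 _) (fun=> mE j).
  rewrite big_const card_unit/= addr0; apply.
  - by move=> [] [].
  - by move=> _ u [].
  - move=> _ u [Su hu]; rewrite /f -scalerA.
    apply: le_trans (integrand_scale Phi PhiC K bK _ _ u T1 Su).
    by rewrite ler_pM2l ?(ltW hu)//; lra.
apply: lt_le_trans lower; rewrite /T mulrDl mulrDl.
have -> : (V + 1) * j.+1%:R / mu1 / j.+1%:R * mu1 = V + 1.
  by field; rewrite !gt_eqF// ltr0n.
have : 0 < 1 / j.+1%:R * mu1 by rewrite mulr_gt0.
by move: (1 / _ * _) => z; lra.
Qed.

Lemma h_proj_sublinear : exists g : 'M[R]_(n.+1, m) -> R,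
  [/\ sublinear g, forall x, x != 0 -> 0 < g x & forall x, h_proj Phi K x = (g x)%:E].
Proof.
have [VE V0] := cone_volume_gt0.
set V := (n.+1%:R%:E * volume K)%E in VE V0.
have [G [cG G0 hG GE]] := cone_integral_gauge (fine V) V0.
have [Sn Sl sub pos] := gauge_sublinear G (fine V) cG G0 V0 hG.
eexists; split; [exact: sub|exact: pos|move=> x].
rewrite /h_proj; case: eqVneq => [->|x0]; first by rewrite (sublinear0 _ sub).
rewrite -ereal_inf_EFin//; congr ereal_inf; rewrite -/V VE.
have IE t : (\int[surface_area K]_(u in usphere)
    (Phi ((t / support_fun K u) *: (u^T *m x)) * support_fun K u)%:E)%E = (G (t *: x))%:E.
  rewrite -GE; congr integral; apply/funext => u.
  by rewrite /integrand -scalemxAr scalerA [_^-1 * t]mulrC.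
apply/seteqP; split=> _ [t [t0 ht] <-].
  exists t^-1 => //; split; first by rewrite invr_gt0.
  by rewrite invrK -lee_fin -IE.
exists t^-1; last by rewrite invrK.
by split; [rewrite invr_gt0|rewrite IE lee_fin].
Qed.

End ConeVolume.

Theorem proposition3p3 (R : realType) (n m : nat)
    (n_gt0 : (0 < n)%N) (m_gt0 : (0 < m)%N)
    (Phi : 'rV[R]_m -> R) (PhiC : orlicz_class Phi)
    (K : set 'cV[R]_n) (Ko : convex_body_o K) :
  exists2 L : set 'M[R]_(n, m),
    convex_body_o L &
    unique (fun L' : set 'M[R]_(n, m) => convex_body L' /\
      forall x, h_proj Phi K x = (support_fun L' x)%:E) L.
Proof.
case: n n_gt0 K Ko => // n _ K Ko.
have [g [sg gpos hE]] := h_proj_sublinear Phi PhiC K Ko.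
have [L Lo Lg] := sublinear_support_fun g sg gpos.
exists L => //; split=> [|L' [bL' hL']].
  by split=> [|x]; [case: Lo|rewrite hE Lg].
apply: support_fun_inj => //; first by case: Lo.
by move=> x; apply: EFin_inj; rewrite -hL' hE Lg.
Qed.
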